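(* For $T>0$ and $\Sigma,\Theta\in\mathbb{P}_n$ let $$S_T(\Sigma,\Theta):=\ln\det(2U_T(\Sigma))+\mathrm{Tr}\big(U_T(\Sigma)+V_T(\Theta)+\chi(U_T(\Sigma)V_T(\Theta))\big),$$ where $$\chi(\omega)=-\sqrt{1+4\omega}-\ln\big(\sqrt{1+4\omega}-1\big),$$ $$U_T(\Sigma):=\Gamma_T^{-1/2}C_T(\Sigma)\Gamma_T^{-1/2}-I_n,\qquad V_T(\Theta)=\Gamma_T^{-1/2}\Theta\,\Gamma_T^{-1/2}.$$ Then $S_T$ is a nonnegative solution of the covariance Hamilton-Jacobi equation $$\partial_TS_T=F(\Sigma,\partial_\Sigma S_T),\qquad F(\Sigma,\Phi):=\mathrm{Tr}\big((\mathcal{C}(\Sigma)-D\Phi\Sigma)\Phi\big)$$ (for $T>0$, $\Sigma,\Theta\succ0$), and it satisfies the boundary condition $S_T(\Sigma,C_T(\Sigma))=0$ for all $T>0$, $\Sigma\succ0$.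
   Context: Let $A\in\mathbb{R}^{n\times n}$ be Hurwitz, $B\in\mathbb{R}^{n\times m}$ with $\mathrm{rank}\,B=n\le m$, and $D:=BB^{\mathrm{T}}\succ0$. $\mathbb{P}_n$ is the set of real positive definite symmetric $n\times n$ matrices. $\Gamma_t:=\int_0^te^{As}De^{A^{\mathrm{T}}s}\,\mathrm{d}s$ (positive definite for $t>0$), $C_t(\Sigma):=e^{At}\Sigma e^{A^{\mathrm{T}}t}+\Gamma_t$, and $\mathcal{C}(\Sigma):=A\Sigma+\Sigma A^{\mathrm{T}}+D$. $\partial_\Sigma$ is the Fréchet derivative with respect to the symmetric matrix $\Sigma$, identified with a symmetric matrix via the inner product $\mathrm{Tr}(XY)$. Functions $\chi$ of matrices are understood in the sense of holomorphic functional calculus; the matrix $U_T(\Sigma)V_T(\Theta)$ is a product of two positive definite matrices, so its eigenvalues are real and positive. *)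

(* Defs.v *)
From HB Require Import structures.
From mathcomp Require Import all_boot all_order all_algebra.
From mathcomp.real_closed Require Import complex.
From mathcomp Require Import all_classical all_reals all_analysis.

Set Implicit Arguments.
Unset Strict Implicit.
Unset Printing Implicit Defensive.
Import Order.TTheory GRing.Theory Num.Theory.
Import numFieldNormedType.Exports.

Local Open Scope classical_set_scope.
Local Open Scope complex_scope.
Local Open Scope ring_scope.

Section RealMatrices.
Context {R : realType} {n : nat}.
Implicit Types (A D M S X Y : 'M[R]_n) (f : 'M[R]_n -> R) (t : R).

Definition posdefmx X : Prop :=
  X^T = X /\ forall v : 'cV[R]_n, v != 0 -> 0 < (v^T *m X *m v) 0 0.

Definition sqrtmx X : 'M[R]_n :=
  xget 0 [set Y | posdefmx Y /\ Y *m Y = X].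

Definition invsqrtmx X : 'M[R]_n := invmx (sqrtmx X).

Definition expmx M : 'M[R]_n :=
  limn (series (fun k => (k`!%:R)^-1 *: M ^+ k)).

Definition complexmx M : 'M[R[i]]_n := map_mx (fun x : R => x%:C) M.

Definition hurwitz A : Prop :=
  forall l : R[i], eigenvalue (complexmx A) l -> complex.Re l < 0.

(* Fréchet gradient of [f] at [X] on the space of symmetric matrices with the
   inner product Tr(XY): increments range over symmetric matrices only. *)
Definition is_symgrad f X (Phi : 'M[R]_n) : Prop :=
  Phi^T = Phi /\
  forall e : R, 0 < e -> \forall H \near (0 : 'M[R]_n), H^T = H ->
    `|f (X + H) - f X - \tr (Phi *m H)| <= e * `|H|.

End RealMatrices.

Section HolomorphicCalculus.
Context {R : realType}.
Local Notation C := R[i].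
Implicit Types (z c w : C) (r t : R).

Definition cmod z : R := Num.sqrt (complex.Re z ^+ 2 + complex.Im z ^+ 2).

Definition expi t : C := cos t +i* sin t.

(* Principal argument, with values in ]-pi, pi] (irrelevant at 0). *)
Definition carg z : R :=
  let a := acos (complex.Re z / cmod z) in
  if 0 <= complex.Im z then a else - a.

(* Principal branches; note that [sqrtC] of the library is not the principal
   branch, as its cut is along the positive half-line. *)
Definition csqrt z : C := (Num.sqrt (cmod z))%:C * expi (carg z / 2).

Definition cln z : C := ln (cmod z) +i* carg z.

Definition Cintegral (D : set R) (f : R -> C) : C :=
  (\int[lebesgue_measure]_(x in D) complex.Re (f x))
    +i* (\int[lebesgue_measure]_(x in D) complex.Im (f x)).

Context {n : nat}.

(* (2 i pi)^-1 * \oint_{|z - c| = r} g(z) (z I - M)^-1 dz, entrywise, along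
   z = c + r e^(it). *)
Definition cauchy_mx (g : C -> C) (M : 'M[C]_n) c r : 'M[C]_n :=
  \matrix_(j, k)
    (((2 * pi)%:C * 'i%C)^-1 *
     Cintegral `[0, 2 * pi] (fun t =>
       let z := c + r%:C * expi t in
       g z * invmx (z%:M - M) j k * ('i%C * r%:C * expi t))).

(* Holomorphic functional calculus for [g] holomorphic on the open set [U]. By
   Cauchy's theorem the value does not depend on the contour; circles bounding
   a disc contained in [U] are enough for a spectrum contained in such a disc,
   e.g. on the open positive half-line with [U] the slit plane. *)
Definition holo_mx (U : set C) (g : C -> C) (M : 'M[C]_n) : 'M[C]_n :=
  xget 0 [set N | exists c r,
    [/\ 0 < r,
        [set z | cmod (z - c) <= r] `<=` U,
        forall l, eigenvalue M l -> cmod (l - c) < r &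
        N = cauchy_mx g M c r]].

Definition slit_plane : set C :=
  ~` [set z | complex.Im z = 0 /\ complex.Re z <= 0].

Definition chi w : C :=
  - csqrt (1 + 4 * w) - cln (csqrt (1 + 4 * w) - 1).

(* [chi] commutes with conjugation, so its value at a real matrix is real. *)
Definition chi_mx (M : 'M[R]_n) : 'M[R]_n :=
  map_mx (@complex.Re R) (holo_mx slit_plane chi (complexmx M)).

End HolomorphicCalculus.

Section Covariance.
Context {R : realType} {n : nat} (A D : 'M[R]_n).
Implicit Types (Sig The Phi : 'M[R]_n) (t : R).

Definition Gam t : 'M[R]_n :=
  \matrix_(j, k) \int[lebesgue_measure]_(s in `[0, t])
    (expmx (s *: A) *m D *m expmx (s *: A^T)) j k.

Definition Ct t Sig : 'M[R]_n :=
  expmx (t *: A) *m Sig *m expmx (t *: A^T) + Gam t.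

Definition Cgen Sig : 'M[R]_n := A *m Sig + Sig *m A^T + D.

Definition UT t Sig : 'M[R]_n :=
  invsqrtmx (Gam t) *m Ct t Sig *m invsqrtmx (Gam t) - 1%:M.

Definition VT t The : 'M[R]_n :=
  invsqrtmx (Gam t) *m The *m invsqrtmx (Gam t).

Definition ST t Sig The : R :=
  ln (\det (2 *: UT t Sig)) +
  \tr (UT t Sig + VT t The + chi_mx (UT t Sig *m VT t The)).

Definition Fham Sig Phi : R :=
  \tr ((Cgen Sig - D *m Phi *m Sig) *m Phi).

End Covariance.

(* Main.v *)
Require Import Defs.
From mathcomp Require Import all_boot all_order all_algebra.
From mathcomp Require Import all_classical all_reals all_analysis.
From mathcomp.real_closed Require Import complex.
From mathcomp Require Import ring lra spectral perm.
Set Implicit Arguments.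
Unset Strict Implicit.
Unset Printing Implicit Defensive.
Import Order.TTheory GRing.Theory Num.Theory.
Import numFieldNormedType.Exports.
Local Open Scope classical_set_scope.
Local Open Scope ring_scope.

(** Put E = e^(TA), M = E Sig E^T, G = Gam T and h = G^(-1/2), so that
    U = h M h and V = h The h. The starting point is a form of the cost from
    which the square root of G has disappeared, the only one left being that of
    the constant matrix The:
<<
      S = n ln 2 + ln det M - ln det G + Tr (G^-1 (M + The)) + Tr chi(K),
      K = The^(1/2) G^-1 M G^-1 The^(1/2)
>>
    ([ST_transported]). It holds because U V is similar to the symmetric matrix
    K through The^(1/2) h, and because the Cauchy integral that defines chi of a
    matrix acts on the eigenvalues when the matrix is diagonalisable with a
    positive spectrum ([chi_mx_diag]); the latter is Cauchy's formula
    for chi on a circle, obtained by contracting the circle ([cauchy_chi]).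

    Derivatives. Apart from a linear term, S is a combination of traces Tr f(L)
    with L positive definite and f convex, f = - ln or f = chi. For such an f,
    Klein's inequality ([klein_ineq]) gives
<<
      Tr (f'(L) (L' - L)) <= Tr f(L') - Tr f(L) <= Tr (f'(L') (L' - L)),
>>
    so that continuity of L |-> f'(L) alone implies differentiability with
    gradient f'(L), and the eigenvalues never have to be differentiated
    ([is_derive_tr_mxfun], [symgrad_tr_mxfun]). Hence the gradient of S in Sig is
<<
      Phi = E^T (M^-1 + G^-1 + Y) E,   Y = G^-1 The^(1/2) X The^(1/2) G^-1,
      X = chi'(K).
>>

    The equation. In time, G' = E D E^T and M' = A M + M A^T. Since chi'(w) is a
    root of x + w x^2 = 1, X + X K X = 1, that is, Y + Y M Y = G^-1 The G^-1. This
    eliminates The from the time derivative, and what remains is an identity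
    between traces ([hj_algebra]).

    Sign. Apply Klein's inequality to chi at U^2 + U and U^(1/2) V U^(1/2), the
    latter similar to U V. As chi(u^2 + u) = - (2 u + 1) - ln (2 u) and
    chi'(u^2 + u) = - 1/u, the lower bound that it gives for Tr chi(U V) is exactly
    - ln det (2 U) - Tr (U + V) ([cost_ge0]). The two arguments coincide when
    V = U + 1, that is, when The = C_T(Sig), and the cost then vanishes
    ([cost_eq0]). *)

(** * Spectral theorem for real symmetric matrices *)

Section SpectralTheorem.
Context {R : realType}.

Lemma invmx_right n (F : fieldType) (A B : 'M[F]_n) : A *m B = 1%:M -> invmx A = B.
Proof.
move=> AB; have [Au _] := mulmx1_unit AB.
by rewrite -[RHS]mul1mx -(mulVmx Au) -mulmxA AB mulmx1.
Qed.

Lemma cV_sqnormE n (v : 'cV[R]_n) : (v^T *m v) 0 0 = \sum_i v i 0 ^+ 2.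
Proof. by rewrite !mxE; apply: eq_bigr => i _; rewrite !mxE expr2. Qed.

Lemma cV_sqnorm_gt0 n (v : 'cV[R]_n) : v != 0 -> 0 < (v^T *m v) 0 0.
Proof.
move=> v0; rewrite cV_sqnormE lt0r sumr_ge0 ?andbT => [|i _]; last exact: sqr_ge0.
apply: contra v0; rewrite psumr_eq0 => [/allP v0|i _]; last exact: sqr_ge0.
apply/eqP/colP => i; rewrite mxE; apply/eqP.
by have := v0 i (mem_index_enum _); rewrite sqrf_eq0.
Qed.

Lemma cV_sqnorm_ge0 n (v : 'cV[R]_n) : 0 <= (v^T *m v) 0 0.
Proof. by rewrite cV_sqnormE sumr_ge0// => i _; exact: sqr_ge0. Qed.

Lemma sym_dotC n (K : 'M[R]_n) (x y : 'cV[R]_n) :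
  K^T = K -> (x^T *m K *m y) 0 0 = (y^T *m K *m x) 0 0.
Proof.
move=> Ks; transitivity ((x^T *m K *m y)^T 0 0); first by rewrite [RHS]mxE.
by rewrite !trmx_mul trmxK Ks mulmxA.
Qed.

Lemma complex_sumE (I : Type) (r : seq I) (F G : I -> R) :
  Complex (\sum_(i <- r) F i) (\sum_(i <- r) G i) =
  \sum_(i <- r) Complex (F i) (G i).
Proof. by elim: r => [|i r IH]; rewrite ?big_nil // !big_cons -IH. Qed.

(** The complexification has an eigenvector x + i y, with eigenvalue al + i be.
    Symmetry makes x^T K y and y^T K x agree, which reads
    be (|x|^2 + |y|^2) = 0; so be = 0 and whichever of x, y is nonzero is a real
    eigenvector. *)
Lemma sym_eigenvector n (K : 'M[R]_n.+1) : K^T = K ->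
  exists l, exists2 v : 'cV[R]_n.+1, v != 0 & K *m v = l *: v.
Proof.
move=> Ks; have [a /eigenvalueP[v va v0]] := eigenvalue_closed (complexmx K) (ltn0Sn n).
pose x : 'cV[R]_n.+1 := \col_i complex.Re (v 0 i).
pose y : 'cV[R]_n.+1 := \col_i complex.Im (v 0 i).
have vE i : v 0 i = Complex (x i 0) (y i 0) by rewrite !mxE; case: (v 0 i).
have KE i : Complex ((K *m x) i 0) ((K *m y) i 0) = a * v 0 i.
  have := congr1 (fun w : 'rV__ => w 0 i) va; rewrite !mxE => <-.
  rewrite complex_sumE.
  by apply: eq_bigr => j _; rewrite vE !mxE -{1 2}Ks !mxE; simpc; rewrite !(mulrC (K j i)).
case: a va KE => al be va KE.
have Kx : K *m x = al *: x - be *: y.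
  apply/colP => i; have := KE i; rewrite vE; simpc => -[-> _].
  by rewrite !mxE.
have Ky : K *m y = al *: y + be *: x.
  apply/colP => i; have := KE i; rewrite vE; simpc => -[_ ->].
  by rewrite !mxE.
have xy0 : 0 < (x^T *m x) 0 0 + (y^T *m y) 0 0.
  have [x0|x0] := eqVneq x 0; last first.
    by rewrite ltr_wpDr ?cV_sqnorm_ge0 ?cV_sqnorm_gt0.
  have [y0|y0] := eqVneq y 0; last first.
    by rewrite ltr_wpDl ?cV_sqnorm_ge0 ?cV_sqnorm_gt0.
  by case/eqP: v0; apply/rowP => i; rewrite vE x0 y0 !mxE.
have be0 : be = 0.
  have xyC : (x^T *m y) 0 0 = (y^T *m x) 0 0.
    by rewrite !mxE; apply: eq_bigr => i _; rewrite !mxE mulrC.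
  have := sym_dotC y x Ks; rewrite -!mulmxA Kx Ky.
  rewrite mulmxBr mulmxDr -!scalemxAr.
  move: (y^T *m x) (x^T *m x) (y^T *m y) (x^T *m y) xyC xy0 => p q r s ps qr.
  rewrite !mxE ps => e.
  have : be * (q 0 0 + r 0 0) = 0 by lra.
  by move/eqP; rewrite mulf_eq0 (gt_eqF qr) orbF => /eqP.
rewrite be0 !scale0r ?subr0 ?addr0 in Kx; rewrite be0 scale0r addr0 in Ky.
exists al.
have [x0|x0] := eqVneq x 0; last by exists x.
exists y => //; apply/eqP => y0; move: xy0.
by rewrite x0 y0 !mulmx0 !mxE addr0 ltxx.
Qed.

(** The reflection exchanging v and the first basis vector e: it is
    H = 1 - 2 u u^T / |u|^2 with u = v - e. *)
Lemma householder n (v : 'cV[R]_n.+1) : (v^T *m v) 0 0 = 1 ->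
  exists H : 'M[R]_n.+1, [/\ H^T = H, H *m H = 1%:M & H *m v = delta_mx 0 0].
Proof.
move=> v1; pose e : 'cV[R]_n.+1 := delta_mx 0 0.
have [<-|ve] := eqVneq e v.
  by exists 1%:M; rewrite trmx1 !mul1mx.
pose u := v - e; pose N := (u^T *m u) 0 0.
have N0 : 0 < N by rewrite cV_sqnorm_gt0 // subr_eq0 eq_sym.
have uu : u^T *m u = N%:M by rewrite [LHS]mx11_scalar.
have ev : (e^T *m v) 0 0 = v 0 0.
  by rewrite trmx_delta -rowE mxE.
have ve0 : (v^T *m e) 0 0 = v 0 0.
  by rewrite -colE !mxE.
have ee : (e^T *m e) 0 0 = 1.
  by rewrite trmx_delta -rowE !mxE !eqxx.
have NE : N = 2 * (1 - v 0 0).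
  rewrite /N /u [(_ - _)^T]raddfB /= mulmxBl !mulmxBr.
  move: (v^T *m v) (v^T *m e) (e^T *m v) (e^T *m e) v1 ev ve0 ee => p q r s h1 h2 h3 h4.
  rewrite !mxE h1 h2 h3 h4; lra.
have uv : u^T *m v = (1 - v 0 0)%:M.
  rewrite [LHS]mx11_scalar; congr (_ %:M).
  rewrite /u [(_ - _)^T]raddfB /= mulmxBl.
  move: (v^T *m v) (e^T *m v) v1 ev => p q h1 h2.
  by rewrite !mxE h1 h2.
exists (1%:M - (2 / N) *: (u *m u^T)); split.
- by rewrite linearB /= linearZ /= trmx1 trmx_mul trmxK.
- rewrite mulmxBl !mulmxBr !mul1mx mulmx1 -!scalemxAl -!scalemxAr scalerA.
  rewrite -mulmxA (mulmxA u^T) uu mul_scalar_mx -scalemxAr scalerA.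
  rewrite (_ : 2 / N * (2 / N) * N = 2 / N + 2 / N); last by field; rewrite gt_eqF.
  rewrite scalerDl; move: ((2 / N) *: _) => X.
  by rewrite opprB addrK subrK.
- rewrite mulmxBl mul1mx -scalemxAl -mulmxA uv mul_mx_scalar scalerA.
  rewrite (_ : _ * _ = 1) ?scale1r ?subKr //.
  by rewrite NE; field; apply: contraTneq N0 => h; rewrite NE h mulr0 ltxx.
Qed.

Definition orthogonalmx n (P : 'M[R]_n) := P *m P^T = 1%:M.

Definition specmx n (P : 'M[R]_n) (a : 'I_n -> R) : 'M[R]_n :=
  P^T *m diag_mx (\row_i a i) *m P.

(** The step of the induction below: a diagonalisation of the lower block gives
    one of the block matrix. *)
Lemma block_specmx n (P : 'M[R]_n) (a : 'I_n -> R) l :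
  (block_mx 1%:M 0 0 P : 'M[R]_(1 + n))^T
    *m diag_mx (row_mx (l%:M : 'M[R]_1) (\row_i a i))
    *m (block_mx 1%:M 0 0 P : 'M[R]_(1 + n)) = block_mx l%:M 0 0 (specmx P a).
Proof.
rewrite diag_mx_row tr_block_mx !mulmx_block !trmx1 !trmx0.
rewrite !(mulmx0, mul0mx, addr0, add0r) mul1mx mulmx1; congr block_mx.
by apply/matrixP => i j; rewrite !ord1 !mxE.
Qed.

(** By induction on the size: a reflection sends a unit eigenvector to the first
    basis vector, and symmetry then splits the conjugated matrix into a scalar
    and a smaller symmetric block. *)
Theorem spectral_sym n (K : 'M[R]_n) : K^T = K ->
  exists P a, orthogonalmx P /\ K = specmx P a.
Proof.
elim: n K => [|n IH] K Ks.
  exists 1%:M, (fun=> 0); split; first by rewrite /orthogonalmx [LHS]flatmx0 [RHS]flatmx0.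
  by rewrite [LHS]flatmx0 [RHS]flatmx0.
have [l [w w0 Kw]] := sym_eigenvector Ks.
pose N := Num.sqrt ((w^T *m w) 0 0).
have N0 : 0 < N by rewrite sqrtr_gt0 cV_sqnorm_gt0.
pose v := N^-1 *: w.
have Kv : K *m v = l *: v by rewrite -scalemxAr Kw !scalerA mulrC.
have v1 : (v^T *m v) 0 0 = 1.
  rewrite /v [(_ *: _)^T]linearZ /= -scalemxAl -scalemxAr scalerA mxE.
  rewrite -[X in _ * X](sqr_sqrtr (cV_sqnorm_ge0 w)) -/N; field; exact: lt0r_neq0.
have [H [Hs HH Hv]] := householder v1.
pose K1 : 'M[R]_(1 + n) := H *m K *m H.
have K1s : K1^T = K1 by rewrite !trmx_mul Hs Ks mulmxA.
have K1e : K1 *m delta_mx 0 0 = l *: (delta_mx 0 0 : 'cV_n.+1).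
  by rewrite -Hv !mulmxA -(mulmxA _ H H) HH mulmx1 -mulmxA Kv -scalemxAr.
have K1c : col 0 K1 = l *: (delta_mx 0 0 : 'cV_n.+1) by rewrite colE K1e.
have KE : K = H *m K1 *m H by rewrite !mulmxA HH mul1mx -mulmxA HH mulmx1.
clearbody K1.
pose K2 := drsubmx K1.
have K2s : K2^T = K2 by rewrite /K2 trmx_drsub K1s.
have K1E : K1 = block_mx l%:M 0 0 K2.
  have c0 i : K1 i 0 = l * (i == 0)%:R.
    by have := congr1 (fun w : 'cV_n.+1 => w i 0) K1c; rewrite !mxE andbT.
  rewrite -[LHS]submxK; congr block_mx.
  - apply/matrixP => i j; rewrite !ord1 !mxE.
    by rewrite (_ : lshift n 0 = 0) ?c0 ?mulr1 //; exact: val_inj.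
  - apply/matrixP => i j; rewrite !ord1 !mxE -K1s mxE.
    by rewrite (_ : lshift n 0 = 0) ?c0 ?mulr0 //; exact: val_inj.
  - apply/matrixP => i j; rewrite !ord1 !mxE.
    by rewrite (_ : lshift n 0 = 0) ?c0 ?mulr0 //; exact: val_inj.
have [P2 [a2 [P2o K2E]]] := IH K2 K2s.
pose P1 : 'M[R]_(1 + n) := block_mx 1%:M 0 0 P2.
exists (P1 *m H), (fun i => row_mx (l%:M : 'M[R]_1) (\row_i a2 i) 0 (i : 'I_(1 + n))); split.
  rewrite /orthogonalmx trmx_mul Hs mulmxA -(mulmxA P1) HH mulmx1.
  rewrite /P1 (@tr_block_mx _ 1 n 1 n) (@mulmx_block _ 1 n 1 n 1 n) !trmx1.
  rewrite !trmx0 !mulmx0 !mul0mx !addr0 !add0r mulmx1 P2o.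
  by rewrite -scalar_mx_block.
rewrite /specmx (_ : \row_i _ = row_mx (l%:M : 'M[R]_1) (\row_i a2 i)); last first.
  by apply/rowP => i; rewrite mxE.
rewrite KE trmx_mul Hs K1E K2E /specmx !mulmxA; congr (_ *m H).
rewrite -!mulmxA; congr (H *m _); rewrite mulmxA.
rewrite mulmxA; exact/esym/block_specmx.
Qed.

Section SpecmxTheory.
Variables (n : nat) (P : 'M[R]_n).
Hypothesis Po : orthogonalmx P.

Lemma orthogonalmx_tr : P^T *m P = 1%:M.
Proof. exact: mulmx1C. Qed.

Lemma specmxM a b : specmx P a *m specmx P b = specmx P (fun i => a i * b i).
Proof.
rewrite /specmx !mulmxA -(mulmxA _ P) Po mulmx1; congr (_ *m _).
rewrite -mulmxA; congr (_ *m _); rewrite mulmx_diag; congr diag_mx.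
by apply/rowP => i; rewrite !mxE.
Qed.

Lemma specmxD a b : specmx P a + specmx P b = specmx P (fun i => a i + b i).
Proof.
rewrite /specmx -mulmxDl -mulmxDr; congr (_ *m _ *m _).
by rewrite -raddfD; congr diag_mx; apply/rowP => i; rewrite !mxE.
Qed.

Lemma specmxZ c a : c *: specmx P a = specmx P (fun i => c * a i).
Proof.
rewrite /specmx scalemxAl scalemxAr -linearZ /=; congr (_ *m diag_mx _ *m _).
by apply/rowP => i; rewrite !mxE.
Qed.

Lemma eq_specmx a b : a =1 b -> specmx P a = specmx P b.
Proof. by move=> ab; congr specmx; apply/funext. Qed.

Lemma specmx1 : specmx P (fun=> 1) = 1%:M.
Proof.
rewrite /specmx (_ : diag_mx _ = 1%:M) ?mulmx1 ?orthogonalmx_tr //.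
by apply/matrixP => i j; rewrite !mxE.
Qed.

Lemma specmx_sym a : (specmx P a)^T = specmx P a.
Proof. by rewrite /specmx !trmx_mul trmxK tr_diag_mx mulmxA. Qed.

Lemma tr_specmx a : \tr (specmx P a) = \sum_i a i.
Proof.
rewrite /specmx mxtrace_mulC mulmxA Po mul1mx mxtrace_diag.
by apply: eq_bigr => i _; rewrite mxE.
Qed.

Lemma det_specmx a : \det (specmx P a) = \prod_i a i.
Proof.
rewrite /specmx !det_mulmx mulrAC -det_mulmx orthogonalmx_tr det1 mul1r det_diag.
by apply: eq_bigr => i _; rewrite mxE.
Qed.

Lemma quad_specmx a (v : 'cV[R]_n) :
  (v^T *m specmx P a *m v) 0 0 = \sum_i a i * (P *m v) i 0 ^+ 2.
Proof.
have -> : v^T *m specmx P a *m v = (P *m v)^T *m diag_mx (\row_i a i) *m (P *m v).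
  by rewrite /specmx trmx_mul !mulmxA.
rewrite mxE; apply: eq_bigr => i _; rewrite mul_mx_diag !mxE.
by rewrite expr2 mulrAC mulrC mulrA.
Qed.

Lemma specmx_posdef a : posdefmx (specmx P a) <-> forall i, 0 < a i.
Proof.
split=> [[_ pa] i|a0].
  have := pa (P^T *m delta_mx i 0); rewrite quad_specmx.
  rewrite (bigD1 i) //= big1 => [|j ji]; last first.
    by rewrite mulmxA Po mul1mx mxE eqxx andbT (negPf ji) expr0n mulr0.
  rewrite mulmxA Po mul1mx mxE !eqxx expr1n mulr1 addr0; apply.
  apply: contraNneq (oner_neq0 R) => /(congr1 (mulmx P)).
  rewrite mulmxA Po mul1mx mulmx0 => /(congr1 (fun w : 'cV_n => w i 0)).
  by rewrite !mxE !eqxx /= => /eqP.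
split=> [|v v0]; first exact: specmx_sym.
have Pv0 : P *m v != 0.
  by apply: contraNneq v0 => h; rewrite -[v]mul1mx -orthogonalmx_tr -mulmxA h mulmx0.
have := cV_sqnorm_gt0 Pv0; rewrite cV_sqnormE quad_specmx => s0.
rewrite lt0r; have t0 i : 0 <= a i * (P *m v) i 0 ^+ 2.
  by rewrite mulr_ge0 ?sqr_ge0 // ltW.
rewrite sumr_ge0 // andbT; apply: contraTneq s0 => /eqP.
rewrite psumr_eq0 // => /allP h; rewrite big1 ?ltxx // => i _.
have := h i (mem_index_enum _); rewrite mulf_eq0 (gt_eqF (a0 i)) => /eqP.
exact.
Qed.

(** The trace of a product of two symmetric matrices only sees the overlaps
    (P Q^T)_ij^2 of their eigenbases; taking a = 1 or b = 1 shows that these form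
    a doubly stochastic matrix. *)
Lemma tr_specmx2 (Q : 'M[R]_n) a b :
  \tr (specmx P a *m specmx Q b) =
  \sum_i \sum_j a i * b j * (P *m Q^T) i j ^+ 2.
Proof.
have -> : \tr (specmx P a *m specmx Q b) =
  \tr (diag_mx (\row_i a i) *m (P *m Q^T) *m diag_mx (\row_i b i) *m (P *m Q^T)^T).
  by rewrite /specmx trmx_mul trmxK -!mulmxA mxtrace_mulC !mulmxA.
apply: eq_bigr => i _; rewrite mxE; apply: eq_bigr => j _.
by rewrite mul_mx_diag mul_diag_mx !mxE; ring.
Qed.

End SpecmxTheory.

(** Klein's inequality. Both sides are sums over pairs of eigenvectors, weighted by
    their squared overlaps, so the scalar tangent inequality can
    be applied pair by pair. *)
Lemma klein_ineq n (f f' : R -> R) (P Q : 'M[R]_n) a b :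
  orthogonalmx P -> orthogonalmx Q ->
  (forall i j, f (a i) + f' (a i) * (b j - a i) <= f (b j)) ->
  \sum_i f (a i) + \tr (specmx P (f' \o a) *m (specmx Q b - specmx P a))
    <= \sum_j f (b j).
Proof.
move=> Po Qo fab; pose r i j := (P *m Q^T) i j ^+ 2.
have trE (g h : 'I_n -> R) : \tr (specmx P g *m specmx Q h) = \sum_i \sum_j g i * h j * r i j.
  exact: tr_specmx2.
have -> : \sum_j f (b j) = \sum_i \sum_j 1 * f (b j) * r i j.
  by rewrite -trE specmx1 // mul1mx tr_specmx.
have -> : \sum_i f (a i) = \sum_i \sum_j f (a i) * 1 * r i j.
  by rewrite -trE (specmx1 Qo) mulmx1 tr_specmx.
rewrite mulmxBr raddfB /= trE specmxM //.
rewrite -[X in \tr X]mulmx1 -(specmx1 Qo) trE -sumrB -big_split /=.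
apply: ler_sum => i _; rewrite -sumrB -big_split /=; apply: ler_sum => j _.
have -> : f (a i) * 1 * r i j + (f' (a i) * b j * r i j - f' (a i) * a i * 1 * r i j)
   = (f (a i) + f' (a i) * (b j - a i)) * r i j by ring.
by rewrite mul1r ler_wpM2r ?sqr_ge0.
Qed.

(** * Positive definite matrices *)

Section PosDef.
Variable n : nat.
Implicit Types X Y C : 'M[R]_n.

Lemma posdef_spec X : posdefmx X ->
  exists P a, [/\ orthogonalmx P, X = specmx P a & forall i, 0 < a i].
Proof.
move=> /[dup] -[Xs _] pX; have [P [a [Po XE]]] := spectral_sym Xs.
by exists P, a; split => //; apply/(specmx_posdef Po); rewrite -XE.
Qed.

Lemma posdef_sqrtmx X : posdefmx X ->
  posdefmx (sqrtmx X) /\ sqrtmx X *m sqrtmx X = X.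
Proof.
move=> /posdef_spec[P [a [Po XE a0]]].
pose r := specmx P (fun i => Num.sqrt (a i)).
apply: (@xgetPex _ 0 [set Y | posdefmx Y /\ Y *m Y = X]); exists r.
split; first by apply/(specmx_posdef Po) => i; rewrite sqrtr_gt0.
by rewrite specmxM // XE; apply: eq_specmx => i; rewrite -expr2 sqr_sqrtr // ltW.
Qed.

Lemma posdef_det X : posdefmx X -> 0 < \det X.
Proof.
move=> /posdef_spec[P [a [Po -> a0]]]; rewrite det_specmx //.
by apply: prodr_gt0.
Qed.

Lemma posdef_unit X : posdefmx X -> X \in unitmx.
Proof. by move=> /posdef_det d0; rewrite unitmxE unitfE gt_eqF. Qed.

Lemma posdef_congr C X : C \in unitmx -> posdefmx X -> posdefmx (C *m X *m C^T).
Proof.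
move=> Cu [Xs pX]; split; first by rewrite !trmx_mul trmxK Xs mulmxA.
move=> v v0; have := pX (C^T *m v); rewrite trmx_mul trmxK !mulmxA; apply.
apply: contraNneq v0 => h; rewrite -[v]mul1mx.
have Ctu : C^T \in unitmx by rewrite unitmx_tr.
by rewrite -(mulVmx Ctu) -mulmxA h mulmx0.
Qed.

Lemma invmx_specmx (P : 'M[R]_n) a : orthogonalmx P -> (forall i, 0 < a i) ->
  invmx (specmx P a) = specmx P (fun i => (a i)^-1).
Proof.
move=> Po a0; have u : specmx P a \in unitmx.
  by apply: posdef_unit; apply/specmx_posdef.
apply: (can_inj (mulKmx u)); rewrite mulmxV // specmxM //.
rewrite -(specmx1 Po); apply: eq_specmx => i.
by rewrite mulfV // gt_eqF.
Qed.

Lemma posdef_inv X : posdefmx X -> posdefmx (invmx X).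
Proof.
move=> /posdef_spec[P [a [Po -> a0]]]; rewrite invmx_specmx //.
by apply/specmx_posdef => // i; rewrite invr_gt0.
Qed.

(** The harmonic bound (1 + sum of a_i^-1)^-1 also covers the empty family, for
    which there is no minimum. *)
Lemma pos_family_lb (a : 'I_n -> R) : (forall i, 0 < a i) ->
  exists2 c, 0 < c & forall i, c <= a i.
Proof.
move=> a0; have s0 : 0 < 1 + \sum_i (a i)^-1.
  by rewrite ltr_pwDl // sumr_ge0 // => i _; rewrite invr_ge0 ltW.
exists (1 + \sum_i (a i)^-1)^-1; first by rewrite invr_gt0.
move=> i; rewrite -[leRHS]invrK lef_pV2 ?posrE ?invr_gt0 //.
rewrite (bigD1 i) //= addrCA lerDl addr_ge0 // sumr_ge0 // => j _.
by rewrite invr_ge0 ltW.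
Qed.

Lemma posdef_coercive X : posdefmx X ->
  exists2 c, 0 < c & forall v : 'cV[R]_n, c * (v^T *m v) 0 0 <= (v^T *m X *m v) 0 0.
Proof.
move=> /posdef_spec[P [a [Po -> a0]]]; have [c c0 ca] := pos_family_lb a0.
exists c => // v; rewrite quad_specmx //.
have -> : v^T *m v = v^T *m specmx P (fun=> 1) *m v by rewrite specmx1 // mulmx1.
rewrite quad_specmx // mulr_sumr; apply: ler_sum => i _.
by rewrite mul1r ler_wpM2r ?sqr_ge0.
Qed.

(** Positive definiteness is an open condition among symmetric matrices. If
    X >= c, an entrywise perturbation of size e changes the quadratic form by at
    most e n |v|^2. *)
Lemma posdef_open X : posdefmx X ->
  exists2 e, 0 < e & forall Y, Y^T = Y -> (forall i j, `|Y i j - X i j| <= e) -> posdefmx Y.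
Proof.
move=> /posdef_coercive[c c0 cX]; pose e := c / (2 * n.+1%:R).
have e0 : 0 < e by rewrite divr_gt0 // mulr_gt0 // ltr0n.
(* The denominator uses n + 1 so that e is positive also for n = 0. *)
exists e => // Y Ys YX; split=> // v v0; have N0 := cV_sqnorm_gt0 v0.
have bound : `|(v^T *m (Y - X) *m v) 0 0| <= e * n%:R * (v^T *m v) 0 0.
  rewrite cV_sqnormE mxE; under eq_bigr do rewrite mxE mulr_suml.
  apply: (le_trans (ler_norm_sum _ _ _)).
  apply: (@le_trans _ _ (\sum_i \sum_j e * ((v i 0 ^+ 2 + v j 0 ^+ 2) / 2))).
    apply: ler_sum => i _; apply: (le_trans (ler_norm_sum _ _ _)).
    apply: ler_sum => j _; rewrite !mxE.
    rewrite (_ : _ * _ * _ = (Y j i - X j i) * (v j 0 * v i 0)); last by ring.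
    rewrite normrM ler_pM //.
    rewrite normrM -(real_normK (num_real (v i 0))) -(real_normK (num_real (v j 0))).
    have := sqr_ge0 (`|v i 0| - `|v j 0|); lra.
  under eq_bigr do rewrite -mulr_sumr -mulr_suml big_split /= sumr_const card_ord.
  rewrite -mulr_sumr -mulr_suml big_split /= sumr_const card_ord -sumrMnl.
  by rewrite sumrMnl -mulr_natr; lra.
rewrite (_ : Y = X + (Y - X)); last by rewrite addrC subrK.
rewrite mulmxDr mulmxDl mxE; move: (cX v) bound N0.
move: (v^T *m (Y - X) *m v) (v^T *m X *m v) (v^T *m v) => p q r.
rewrite ler_norml => cq /andP[b _] N0.
have : e * n%:R < c.
  rewrite /e mulrAC ltr_pdivrMr ?mulr_gt0 ?ltr0n // ltr_pM2l //.
  by rewrite -natrM ltr_nat mul2n -addnn addSn ltnS (leq_trans _ (leq_addl _ _)).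
move=> ec; have : e * n%:R * r 0 0 < c * r 0 0 by rewrite ltr_pM2r.
by move=> h; lra.
Qed.

End PosDef.

End SpectralTheorem.

(** * Limits and derivatives of matrix-valued functions *)

Section MatrixCurves.
Context {R : realType}.

Lemma is_derive1P (f : R -> R) (t l : R) :
  is_derive t 1 f l <-> h^-1 * (f (h + t) - f t) @[h --> 0^'] --> l.
Proof.
have E : (fun h => h^-1 *: ((f \o shift t) (h *: (1 : R)) - f t)) =
         (fun h => h^-1 * (f (h + t) - f t)).
  by apply/funext => h /=; rewrite [h *: 1]mulr1.
split=> [[df <-]|H].
  by move: df; rewrite /derivable /derive E => /cvgP.
apply: DeriveDef; first by rewrite /derivable E; apply/cvg_ex; exists l.
by rewrite /derive E; exact/cvg_lim.
Qed.

Lemma is_derive_add (u v : R -> R) (t a b : R) :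
  is_derive t 1 u a -> is_derive t 1 v b -> is_derive t 1 (fun s => u s + v s) (a + b).
Proof. exact: is_deriveD. Qed.

Lemma is_derive_sub (u v : R -> R) (t a b : R) :
  is_derive t 1 u a -> is_derive t 1 v b -> is_derive t 1 (fun s => u s - v s) (a - b).
Proof. exact: is_deriveB. Qed.

Lemma is_derive_opp (u : R -> R) (t a : R) :
  is_derive t 1 u a -> is_derive t 1 (fun s => - u s) (- a).
Proof. exact: is_deriveN. Qed.

Lemma is_derive_mul (u v : R -> R) (t a b : R) :
  is_derive t 1 u a -> is_derive t 1 v b ->
  is_derive t 1 (fun s => u s * v s) (a * v t + u t * b).
Proof.
move=> du dv; rewrite addrC [a * _]mulrC.
exact: (@is_deriveM _ _ u v t 1 a b du dv).
Qed.

Lemma is_derive_scal (c : R) (u : R -> R) (t a : R) :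
  is_derive t 1 u a -> is_derive t 1 (fun s => c * u s) (c * a).
Proof. exact: is_deriveZ. Qed.

Lemma is_derive_inv (u : R -> R) (t a : R) : u t != 0 ->
  is_derive t 1 u a -> is_derive t 1 (fun s => (u s)^-1) (- (u t) ^- 2 * a).
Proof. move=> u0 ua; exact: is_deriveV. Qed.

Lemma is_derive_comp (u v : R -> R) (t a b : R) :
  is_derive (v t) 1 u a -> is_derive t 1 v b ->
  is_derive t 1 (fun s => u (v s)) (a * b).
Proof. exact: is_derive1_comp. Qed.

Lemma cvg_bigsum T (F : set_system T) {FF : Filter F} (I : Type) (r : seq I)
    (P : pred I) (f : I -> T -> R) (l : I -> R) :
  (forall i, P i -> f i x @[x --> F] --> l i) ->
  \sum_(i <- r | P i) f i x @[x --> F] --> \sum_(i <- r | P i) l i.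
Proof.
move=> fl; elim: r => [|i r IH].
  by rewrite big_nil; under eq_fun do rewrite big_nil; exact: cvg_cst.
rewrite big_cons; under eq_fun do rewrite big_cons.
by case: ifP => // Pi; apply: cvgD => //; exact: fl.
Qed.

Lemma cvg_bigprod T (F : set_system T) {FF : Filter F} (I : Type) (r : seq I)
    (P : pred I) (f : I -> T -> R) (l : I -> R) :
  (forall i, P i -> f i x @[x --> F] --> l i) ->
  \prod_(i <- r | P i) f i x @[x --> F] --> \prod_(i <- r | P i) l i.
Proof.
move=> fl; elim: r => [|i r IH].
  by rewrite big_nil; under eq_fun do rewrite big_nil; exact: cvg_cst.
rewrite big_cons; under eq_fun do rewrite big_cons.
by case: ifP => // Pi; apply: cvgM => //; exact: fl.
Qed.

Lemma near_eq_derivable (f g : R -> R) (t : R) :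
  (\forall x \near t, f x = g x) -> derivable f t 1 -> derivable g t 1.
Proof.
by move=> fg df; have [] := near_eq_is_derive fg (derivableP df).
Qed.

Lemma is_derive_bigsum (I : Type) (r : seq I) (P : pred I) (f : I -> R -> R)
    (t : R) (df : I -> R) :
  (forall i, P i -> is_derive t 1 (f i) (df i)) ->
  is_derive t 1 (fun x => \sum_(i <- r | P i) f i x) (\sum_(i <- r | P i) df i).
Proof.
move=> fl; elim: r => [|i r IH].
  by rewrite big_nil; under eq_fun do rewrite big_nil; exact: is_derive_cst.
rewrite big_cons; under eq_fun do rewrite big_cons.
by case: ifP => // Pi; apply: is_deriveD => //; exact: fl.
Qed.

Lemma derivable_bigprod (I : Type) (r : seq I) (P : pred I) (f : I -> R -> R)
    (t : R) :
  (forall i, P i -> derivable (f i) t 1) ->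
  derivable (fun x => \prod_(i <- r | P i) f i x) t 1.
Proof.
move=> fl; elim: r => [|i r IH].
  by under eq_fun do rewrite big_nil; exact: derivable_cst.
under eq_fun do rewrite big_cons.
by case: ifP => // Pi; exact: derivableM (fl i Pi) IH.
Qed.

(** Convergence and differentiability of matrices are taken entrywise: sums,
    products, determinants and traces are then polynomials in scalar functions,
    and rectangular and empty matrices need no special treatment. *)
Definition mxcvg T (F : set_system T) m n (K_ : T -> 'M[R]_(m, n)) (K : 'M[R]_(m, n)) :=
  forall i j, K_ x i j @[x --> F] --> K i j.

Definition is_dermx m n (t : R) (K_ : R -> 'M[R]_(m, n)) (K' : 'M[R]_(m, n)) :=
  forall i j, is_derive t 1 (fun x => K_ x i j) (K' i j).

Section Mxcvg.
Context {T : Type} {F : set_system T} {FF : Filter F}.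

Lemma mxcvg_cst m n (K : 'M[R]_(m, n)) : mxcvg F (fun=> K) K.
Proof. by move=> i j; exact: cvg_cst. Qed.

Lemma mxcvgD m n (K_ L_ : T -> 'M[R]_(m, n)) K L :
  mxcvg F K_ K -> mxcvg F L_ L -> mxcvg F (fun x => K_ x + L_ x) (K + L).
Proof.
move=> KK LL i j; rewrite mxE; under eq_fun do rewrite mxE.
exact: cvgD.
Qed.

Lemma mxcvgM m n p (K_ : T -> 'M[R]_(m, n)) (L_ : T -> 'M[R]_(n, p)) K L :
  mxcvg F K_ K -> mxcvg F L_ L -> mxcvg F (fun x => K_ x *m L_ x) (K *m L).
Proof.
move=> KK LL i j; rewrite mxE; under eq_fun do rewrite mxE.
by apply: cvg_bigsum => k _; exact: cvgM.
Qed.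

Lemma mxcvgZ m n c (K_ : T -> 'M[R]_(m, n)) K :
  mxcvg F K_ K -> mxcvg F (fun x => c *: K_ x) (c *: K).
Proof.
move=> KK i j; rewrite mxE; under eq_fun do rewrite mxE.
by apply: cvgM => //; exact: cvg_cst.
Qed.

Lemma cvg_trmx n (K_ : T -> 'M[R]_n) K :
  mxcvg F K_ K -> \tr (K_ x) @[x --> F] --> \tr K.
Proof. by move=> KK; apply: cvg_bigsum. Qed.

Lemma cvg_det n (K_ : T -> 'M[R]_n) K :
  mxcvg F K_ K -> \det (K_ x) @[x --> F] --> \det K.
Proof.
move=> KK; apply: cvg_bigsum => s _; apply: cvgM; first exact: cvg_cst.
by apply: cvg_bigprod.
Qed.

Lemma mxcvg_inv n (K_ : T -> 'M[R]_n) K : K \in unitmx ->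
  (\forall x \near F, K_ x \in unitmx) ->
  mxcvg F K_ K -> mxcvg F (fun x => invmx (K_ x)) (invmx K).
Proof.
move=> Ku Kxu KK i j; rewrite /invmx Ku !mxE.
apply: (@cvg_trans _ ((\det (K_ x))^-1 * (\adj (K_ x)) i j @[x --> F])).
  apply: near_eq_cvg; near=> x.
  have -> : K_ x \in unitmx by near: x.
  by rewrite [RHS]mxE.
apply: cvgM.
  by apply: cvgV; [rewrite -unitfE -unitmxE|exact: cvg_det].
under eq_fun do rewrite mxE.
rewrite /cofactor; apply: cvgM; first exact: cvg_cst.
by apply: cvg_det => k l; under eq_fun do rewrite !mxE; rewrite !mxE; exact: KK.
Unshelve. all: by end_near. Qed.

Lemma mxcvg_near m n (K_ : T -> 'M[R]_(m, n)) K e : 0 < e ->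
  mxcvg F K_ K -> \forall x \near F, forall i j, `|K_ x i j - K i j| <= e.
Proof.
move=> e0 KK; apply: filter_forall => i; apply: filter_forall => j.
by have /cvgrPdistC_le := KK i j; apply.
Qed.

End Mxcvg.

Lemma is_dermx_cvg m n t (K_ : R -> 'M[R]_(m, n)) K' : is_dermx t K_ K' ->
  mxcvg (nbhs t) K_ (K_ t).
Proof.
move=> dK i j; have [d _] := dK i j.
by have /derivable1_diffP/differentiable_continuous := d.
Qed.

Lemma is_dermx_cst m n t (K : 'M[R]_(m, n)) : is_dermx t (fun=> K) 0.
Proof. by move=> i j; rewrite mxE; exact: is_derive_cst. Qed.

Lemma is_dermxD m n t (K_ L_ : R -> 'M[R]_(m, n)) K' L' :
  is_dermx t K_ K' -> is_dermx t L_ L' ->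
  is_dermx t (fun x => K_ x + L_ x) (K' + L').
Proof.
move=> dK dL i j; rewrite mxE; under eq_fun do rewrite mxE.
exact: is_deriveD.
Qed.

Lemma is_dermxM m n p t (K_ : R -> 'M[R]_(m, n)) (L_ : R -> 'M[R]_(n, p)) K' L' :
  is_dermx t K_ K' -> is_dermx t L_ L' ->
  is_dermx t (fun x => K_ x *m L_ x) (K' *m L_ t + K_ t *m L').
Proof.
move=> dK dL i j; rewrite 3!mxE -big_split /=; under eq_fun do rewrite mxE.
by apply: is_derive_bigsum => k _; exact: is_derive_mul.
Qed.

Lemma is_derive_trmx n t (K_ : R -> 'M[R]_n) K' :
  is_dermx t K_ K' -> is_derive t 1 (fun x => \tr (K_ x)) (\tr K').
Proof. by move=> dK; apply: is_derive_bigsum. Qed.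

Lemma derivable_det n t (K_ : R -> 'M[R]_n) :
  (forall i j, derivable (fun x => K_ x i j) t 1) ->
  derivable (fun x => \det (K_ x)) t 1.
Proof.
move=> dK.
pose s_ (s : 'S_n) x := (-1) ^+ s * \prod_i K_ x i (s i).
have h (s : 'S_n) : derivable (s_ s) t 1.
  by apply: derivableM; [exact: derivable_cst|exact: derivable_bigprod].
have := @is_derive_bigsum _ (index_enum 'S_n) xpredT s_ t (fun s => 'D_1 (s_ s) t).
by case=> [s _|//]; exact: derivableP.
Qed.

(** Cramer's formula shows that the inverse is differentiable; the value of the
    derivative then comes from differentiating K K^-1 = 1. *)
Lemma is_dermx_inv n t (K_ : R -> 'M[R]_n) K' :
  (\forall x \near t, K_ x \in unitmx) -> is_dermx t K_ K' ->
  is_dermx t (fun x => invmx (K_ x)) (- (invmx (K_ t) *m K' *m invmx (K_ t))).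
Proof.
move=> Ku dK.
have d i j : derivable (fun x => invmx (K_ x) i j) t 1.
  suff : derivable (fun x => (\det (K_ x))^-1 * (\adj (K_ x)) i j) t 1.
    apply: near_eq_derivable; near=> x; rewrite /invmx.
    have -> : K_ x \in unitmx by near: x.
    by rewrite [RHS]mxE.
  apply: derivableM.
    apply: derivableV; last by apply: derivable_det => k l; have [] := dK k l.
    by rewrite -unitfE -unitmxE (nbhs_singleton Ku).
  under eq_fun do rewrite mxE.
  apply: derivableM; first exact: derivable_cst.
  apply: derivable_det => k l; under eq_fun do rewrite !mxE.
  by have [] := dK (lift j k) (lift i l).
pose N := \matrix_(i, j) 'D_1 (fun x => invmx (K_ x) i j) t.
have dN : is_dermx t (fun x => invmx (K_ x)) N.
  by move=> i j; rewrite mxE; exact: derivableP.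
have dKN := is_dermxM dK dN.
suff -> : - (invmx (K_ t) *m K' *m invmx (K_ t)) = N by [].
have K0 : K' *m invmx (K_ t) + K_ t *m N = 0.
  apply/matrixP => i j; have [_ <-] := dKN i j; rewrite mxE.
  suff [_ ->] : is_derive t 1 (fun x => (K_ x *m invmx (K_ x)) i j) 0 by [].
  apply: (near_eq_is_derive (f := cst ((1%:M : 'M[R]_n) i j))).
  by near=> x; rewrite mulmxV //; near: x; exact: Ku.
have Ktu := nbhs_singleton Ku.
rewrite -mulmxA -mulmxN -(mulKmx Ktu N); congr (_ *m _).
by apply/esym/eqP; rewrite -addr_eq0 addrC K0.
Unshelve. all: by end_near. Qed.

End MatrixCurves.

(** * Differentiability of convex trace functions *)

Section TraceFunctions.
Context {R : realType}.

Lemma quad_sum_col n (s : 'M[R]_n) (D : 'M[R]_n) :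
  \tr (D^T *m s *m D) = \sum_j ((col j D)^T *m s *m col j D) 0 0.
Proof.
apply: eq_bigr => j _; rewrite !mxE; apply: eq_bigr => k _; rewrite !mxE.
by congr (_ * _); apply: eq_bigr => l _; rewrite !mxE.
Qed.

Definition fnorm2 n (D : 'M[R]_n) := \sum_i \sum_j D i j ^+ 2.

Lemma tr_fnorm2 n (D : 'M[R]_n) : \tr (D^T *m D) = fnorm2 D.
Proof.
rewrite /fnorm2 exchange_big /=; apply: eq_bigr => j _; rewrite !mxE.
by apply: eq_bigr => i _; rewrite !mxE expr2.
Qed.

Lemma tr_coercive n (s D : 'M[R]_n) :
  (forall v : 'cV[R]_n, (v^T *m v) 0 0 <= (v^T *m s *m v) 0 0) ->
  fnorm2 D <= \tr (D^T *m s *m D).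
Proof.
move=> hs; rewrite -tr_fnorm2 -[in leLHS](mulmx1 D^T) !quad_sum_col.
by apply: ler_sum => j _; rewrite mulmx1.
Qed.

(** The matrix square root is Lipschitz on matrices whose root is at least 1.
    With D = s - s' one has s^2 - s'^2 = s D + D s'; pairing with D and using
    s, s' >= 1 gives 2 |D|^2 <= <D, s^2 - s'^2>, whose right-hand side is at most
    |D|^2 + |s^2 - s'^2|^2. *)
Lemma sqrt_lipschitz n (s s' : 'M[R]_n) : s^T = s -> s'^T = s' ->
  (forall v : 'cV[R]_n, (v^T *m v) 0 0 <= (v^T *m s *m v) 0 0) ->
  (forall v : 'cV[R]_n, (v^T *m v) 0 0 <= (v^T *m s' *m v) 0 0) ->
  fnorm2 (s - s') <= fnorm2 (s *m s - s' *m s').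
Proof.
move=> ss s's hs hs'; set D := s - s'; set Z := s *m s - s' *m s'.
have Ds : D^T = D by rewrite /D raddfB /= ss s's.
have ZE : Z = s *m D + D *m s'.
  by rewrite /Z /D mulmxBr mulmxBl addrA subrK.
have h : fnorm2 D + fnorm2 D <= \tr (D *m Z).
  rewrite ZE mulmxDr raddfD /= [in X in _ <= _ + X]mulmxA (mxtrace_mulC (D *m D)).
  rewrite mulmxA lerD //.
    by have := tr_coercive D hs; rewrite Ds.
  have -> : \tr (s' *m (D *m D)) = \tr (D *m s' *m D).
    by rewrite [LHS]mxtrace_mulC -[in LHS]mulmxA [LHS]mxtrace_mulC.
  by have := tr_coercive D hs'; rewrite Ds.
have h2 : \tr (D *m Z) <= fnorm2 D + fnorm2 Z.
  rewrite /fnorm2 -big_split /=; apply: ler_sum => i _; rewrite mxE -big_split /=.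
  have -> : \sum_j (D i j ^+ 2 + Z i j ^+ 2) = \sum_j (D i j ^+ 2 + Z j i ^+ 2).
    have Zs : Z^T = Z by rewrite /Z raddfB /= !trmx_mul ss s's.
    by apply: eq_bigr => j _; congr (_ + _ ^+ 2); rewrite -[in LHS]Zs [LHS]mxE.
  apply: ler_sum => j _.
  have := sqr_ge0 (D i j - Z j i); have := sqr_ge0 (D i j + Z j i).
  rewrite sqrrB sqrrD; lra.
by rewrite -(lerD2l (fnorm2 D)); exact: le_trans h h2.
Qed.

Lemma fnorm2_ge n (D : 'M[R]_n) i j : D i j ^+ 2 <= fnorm2 D.
Proof.
rewrite /fnorm2 (bigD1 i) //= (bigD1 j) //= -addrA lerDl addr_ge0 //.
  by apply: sumr_ge0 => *; exact: sqr_ge0.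
by apply: sumr_ge0 => *; apply: sumr_ge0 => *; exact: sqr_ge0.
Qed.

(** A diagonalisation chosen once for each matrix, so that all functions of one
    matrix share an eigenbasis and can be multiplied eigenvalue by eigenvalue. *)
Definition eigdec n (K : 'M[R]_n) : 'M[R]_n * ('I_n -> R) :=
  xget (0, fun=> 0) [set Pa | orthogonalmx Pa.1 /\ K = specmx Pa.1 Pa.2].

Definition mxfun n (f : R -> R) (K : 'M[R]_n) : 'M[R]_n :=
  specmx (eigdec K).1 (f \o (eigdec K).2).

Lemma eigdecP n (K : 'M[R]_n) : posdefmx K ->
  [/\ orthogonalmx (eigdec K).1, K = specmx (eigdec K).1 (eigdec K).2 &
      forall i, 0 < (eigdec K).2 i].
Proof.
move=> /posdef_spec[P [a [Po KE a0]]].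
have [eo eE] : [set Pa | orthogonalmx Pa.1 /\ K = specmx Pa.1 Pa.2] (eigdec K).
  by apply: xgetPex; exists (P, a).
split=> //; apply/(specmx_posdef eo); rewrite -eE KE.
exact/(specmx_posdef Po).
Qed.

Lemma mxfun_sym n f (K : 'M[R]_n) : (mxfun f K)^T = mxfun f K.
Proof. by rewrite /mxfun specmx_sym. Qed.

(** Convexity of f on the positive half-line, in the form that Klein's inequality
    uses: f lies above the lines of slope f'. *)
Definition tangent_below (f f' : R -> R) :=
  forall a b, 0 < a -> 0 < b -> f a + f' a * (b - a) <= f b.

Lemma tr_tangent_below n f f' (K L : 'M[R]_n) : tangent_below f f' ->
  posdefmx K -> posdefmx L ->
  \tr (mxfun f K) + \tr (mxfun f' K *m (L - K)) <= \tr (mxfun f L).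
Proof.
move=> ff' /eigdecP[Ko KE K0] /eigdecP[Lo LE L0].
rewrite [X in _ *m X](_ : _ = specmx (eigdec L).1 (eigdec L).2 - specmx (eigdec K).1 (eigdec K).2).
  rewrite /mxfun !tr_specmx //; apply: klein_ineq => // i j.
  exact: ff'.
by rewrite -LE -KE.
Qed.

(** Continuity along an arbitrary filter serves both kinds of derivative: in
    time along a punctured neighbourhood, in the covariance along neighbourhoods
    restricted to symmetric increments. *)
Definition mxfun_cont n (g : R -> R) :=
  forall (T : Type) (F : set_system T) (FF : Filter F) (K_ : T -> 'M[R]_n) K,
    posdefmx K -> (\forall x \near F, posdefmx (K_ x)) ->
    mxcvg F K_ K -> mxcvg F (fun x => mxfun g (K_ x)) (mxfun g K).

(** Applying the tangent inequality at K_t and at K_(t + h) encloses the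
    difference quotient between Tr (f'(K_t) q) and Tr (f'(K_(t + h)) q), where q
    is the difference quotient of K; both have the same limit by continuity of
    f'. *)
Lemma is_derive_tr_mxfun n f f' t (K_ : R -> 'M[R]_n) K' :
  tangent_below f f' -> mxfun_cont n f' ->
  (\forall x \near t, posdefmx (K_ x)) -> is_dermx t K_ K' ->
  is_derive t 1 (fun x => \tr (mxfun f (K_ x))) (\tr (mxfun f' (K_ t) *m K')).
Proof.
move=> ff' cf' pK dK; apply/is_derive1P.
have pKt := nbhs_singleton pK.
have ht : h + t @[h --> 0^'] --> t.
  suff : h + t @[h --> 0^'] --> 0 + t by rewrite add0r.
  apply: cvg_within_filter; apply: cvgD; [exact: cvg_id|exact: cvg_cst].
have pKh : \forall h \near 0^', posdefmx (K_ (h + t)) := ht _ pK.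
have KKh : mxcvg 0^' (fun h => K_ (h + t)) (K_ t).
  have := is_dermx_cvg dK => c i j.
  exact: (@cvg_comp _ _ _ (fun h => h + t) (fun x => K_ x i j) _ (nbhs t) _ ht (c i j)).
have gK := cf' _ _ (dnbhs_filter 0) _ _ pKt pKh KKh.
pose q h := h^-1 *: (K_ (h + t) - K_ t).
have qK' : mxcvg 0^' q K'.
  by move=> i j; have /is_derive1P := dK i j; under [in X in _ -> X]eq_fun do rewrite !mxE.
pose G h := mxfun f' (K_ (h + t)).
have c1 : \tr (mxfun f' (K_ t) *m q h) @[h --> 0^'] --> \tr (mxfun f' (K_ t) *m K').
  by apply: cvg_trmx; apply: mxcvgM => //; exact: mxcvg_cst.
have c2 : \tr (G h *m q h) @[h --> 0^'] --> \tr (mxfun f' (K_ t) *m K').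
  by apply: cvg_trmx; apply: mxcvgM.
have c3 : `|\tr (G h *m q h) - \tr (mxfun f' (K_ t) *m q h)| @[h --> 0^'] --> 0.
  have c4 : `|\tr (G h *m q h) - \tr (mxfun f' (K_ t) *m q h)| @[h --> 0^']
      --> `|\tr (mxfun f' (K_ t) *m K') - \tr (mxfun f' (K_ t) *m K')|.
    exact: cvg_norm (cvgB c2 c1).
  have E : `|\tr (mxfun f' (K_ t) *m K') - \tr (mxfun f' (K_ t) *m K')| = 0.
    by rewrite subrr normr0.
  by rewrite E in c4.
apply: cvg_sub0 c1; apply: norm_cvg0.
apply: (squeeze_cvgr _ (cvg_cst 0) c3); near=> h.
rewrite normr_ge0 /=.
have ph : posdefmx (K_ (h + t)) by near: h.
have h0 : h != 0 by near: h; exact: nbhs_dnbhs_neq.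
have t1 := tr_tangent_below ff' pKt ph.
have t2 := tr_tangent_below ff' ph pKt.
change (`|h^-1 * (\tr (mxfun f (K_ (h + t))) - \tr (mxfun f (K_ t)))
  - \tr (mxfun f' (K_ t) *m q h)| <=
  `|\tr (G h *m q h) - \tr (mxfun f' (K_ t) *m q h)|).
rewrite /q -!scalemxAr !mxtraceZ -!mulrBr !normrM ler_wpM2l // -/(G h).
have E : \tr (G h *m (K_ t - K_ (h + t))) = - \tr (G h *m (K_ (h + t) - K_ t)).
  by rewrite -raddfN -mulmxN opprB.
rewrite -/(G h) E in t2.
rewrite !ger0_norm; lra.
Unshelve. all: by end_near. Qed.

(** The same enclosure for increments H of X: the error is at most
    |Tr ((G_1 - G_0) H)|, where G_0 and G_1 are the gradients at X and X + H. *)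
Lemma symgrad_tr_mxfun n f f' (C X : 'M[R]_n) :
  tangent_below f f' -> mxfun_cont n f' -> C \in unitmx -> posdefmx X ->
  is_symgrad (fun Y => \tr (mxfun f (C *m Y *m C^T))) X
    (C^T *m mxfun f' (C *m X *m C^T) *m C).
Proof.
move=> ff' cf' Cu pX; split.
  by rewrite trmx_mul [(_ *m mxfun _ _)^T]trmx_mul mxfun_sym trmxK mulmxA.
move=> e e0; pose KX := C *m X *m C^T.
have pKX : posdefmx KX by exact: posdef_congr.
have [d d0 Xd] := posdef_open pX.
pose F := within [set H : 'M[R]_n | H^T = H] (nbhs (0 : 'M[R]_n)).
have FF : Filter F by exact: within_filter.
have H0 : mxcvg F id 0.
  by move=> i j; apply: cvg_within_filter; exact: (@coord_continuous _ n n i j 0).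
have XH : mxcvg F (fun H => X + H) X.
  by rewrite -[X in mxcvg _ _ X]addr0; apply: mxcvgD => //; exact: mxcvg_cst.
have Fs : \forall H \near F, H^T = H by rewrite /F near_withinE; exact: nearW.
have pXH : \forall H \near F, posdefmx (X + H).
  near=> H; have Hs : H^T = H by near: H.
  apply: Xd; first by rewrite raddfD /= Hs (proj1 pX).
  by near: H; exact: mxcvg_near.
have pKH : \forall H \near F, posdefmx (C *m (X + H) *m C^T).
  by apply: filterS pXH => H; exact: posdef_congr.
have KH : mxcvg F (fun H => C *m (X + H) *m C^T) KX.
  by apply: mxcvgM; [apply: mxcvgM => //|]; exact: mxcvg_cst.
have gK := cf' _ _ FF _ _ pKX pKH KH.
have gC : mxcvg F (fun H => C^T *m mxfun f' (C *m (X + H) *m C^T) *m C) (C^T *m mxfun f' KX *m C).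
  by apply: mxcvgM; [apply: mxcvgM => //|]; exact: mxcvg_cst.
(* A trace pairing has n^2 terms, so gradients that are entrywise b-close change
   it by at most n^2 b |H| <= e |H|. *)
pose b := e / (n%:R * n%:R + 1).
have n0 : 0 < n%:R * n%:R + 1 :> R by rewrite ltr_wpDl // mulr_ge0.
have b0 : 0 < b by rewrite divr_gt0.
have := @mxcvg_near _ _ _ FF _ _ _ _ _ b0 gC; rewrite /F near_withinE => nb.
move: pKH; rewrite near_withinE => pKH.
near=> H => Hs.
have pK : posdefmx (C *m (X + H) *m C^T) by move: (Hs); near: H.
have Hb : forall i j, `|(C^T *m mxfun f' (C *m (X + H) *m C^T) *m C) i j
    - (C^T *m mxfun f' KX *m C) i j| <= b.
  by move: (Hs); near: H.
have t1 := tr_tangent_below ff' pKX pK.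
have t2 := tr_tangent_below ff' pK pKX.
have dE : C *m (X + H) *m C^T - KX = C *m H *m C^T.
  by rewrite /KX mulmxDr mulmxDl addrC addKr.
have trE (G : 'M[R]_n) : \tr (G *m (C *m H *m C^T)) = \tr (C^T *m G *m C *m H).
  by rewrite !mulmxA mxtrace_mulC !mulmxA.
rewrite -opprB mulmxN raddfN /= dE trE in t2.
rewrite dE trE in t1.
set G1 := C^T *m _ *m C in t2 Hb; rewrite -/G1 in t2.
set G0 := C^T *m mxfun f' KX *m C in t1 Hb *.
clearbody G0 G1.
have bound : \tr (G1 *m H) - \tr (G0 *m H) <= e * `|H|.
  rewrite -raddfB -mulmxBl /=; apply: (le_trans (ler_norm _)).
  apply: (le_trans (ler_norm_sum _ _ _)).
  apply: (@le_trans _ _ (\sum_(i < n) \sum_(j < n) b * `|H|)).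
    apply: ler_sum => i _; rewrite mxE; apply: (le_trans (ler_norm_sum _ _ _)).
    apply: ler_sum => j _; rewrite normrM !mxE ler_pM //.
    rewrite [leRHS]/Num.Def.normr /= mx_normrE.
    exact: (le_bigmax _ (fun ij => `|H ij.1 ij.2|) (j, i)).
  rewrite !sumr_const !card_ord -mulrnA -[leLHS]mulr_natr natrM /b.
  rewrite [leLHS](_ : _ = (n%:R * n%:R) / (n%:R * n%:R + 1) * (e * `|H|)); last first.
    by field; rewrite gt_eqF.
  by rewrite ler_piMl ?mulr_ge0 ?(ltW e0) // ler_pdivrMr // mul1r lerDl.
rewrite ger0_norm; lra.
Unshelve. all: by end_near. Qed.

End TraceFunctions.

(** * The function chi on the positive half-line *)

Section ChiReal.
Context {R : realType}.

Definition chiR (w : R) : R := - Num.sqrt (1 + 4 * w) - ln (Num.sqrt (1 + 4 * w) - 1).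

(** With s = sqrt (1 + 4 w), the derivative - 2 / (s - 1) of chi, written so that
    as a function of a matrix it only involves the square root and the inverse. *)
Definition dchiR (w : R) : R := - (1 + Num.sqrt (1 + 4 * w)) / (2 * w).

Lemma sqrt14_gt1 (w : R) : 0 < w -> 1 < Num.sqrt (1 + 4 * w).
Proof. by move=> w0; rewrite -[ltLHS]sqrtr1 ltr_sqrt; lra. Qed.

Lemma sqr_sqrt14 (w : R) : 0 < w -> Num.sqrt (1 + 4 * w) ^+ 2 = 1 + 4 * w.
Proof. by move=> w0; rewrite sqr_sqrtr //; lra. Qed.

Lemma dchiRE (w : R) : 0 < w -> dchiR w = - 2 / (Num.sqrt (1 + 4 * w) - 1).
Proof.
move=> w0; have s1 := sqrt14_gt1 w0; have s2 := sqr_sqrt14 w0.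
rewrite /dchiR; move: (Num.sqrt _) s1 s2 => s s1 s2.
have -> : w = (s ^+ 2 - 1) / 4 by lra.
field; rewrite (_ : s^+2 - 1 = (s - 1) * (s + 1)); last by ring.
by rewrite mulf_neq0 !gt_eqF //; lra.
Qed.

Lemma ln_le_sub1 (x : R) : 0 < x -> ln x <= x - 1.
Proof.
move=> x0; have h : -1 < x - 1 by lra.
by have := le_ln1Dx h; rewrite addrC subrK.
Qed.

Lemma ln_bigprod (I : Type) (r : seq I) (F : I -> R) : (forall i, 0 < F i) ->
  ln (\prod_(i <- r) F i) = \sum_(i <- r) ln (F i).
Proof.
move=> F0; elim: r => [|i r IH]; first by rewrite !big_nil ln1.
by rewrite !big_cons lnM ?IH ?posrE ?F0 // prodr_gt0.
Qed.

Lemma nln_tangent : tangent_below (fun x : R => - ln x) (fun x => - x^-1).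
Proof.
move=> a b a0 b0; have := ln_le_sub1 (divr_gt0 b0 a0).
rewrite ln_div // => h.
have : a^-1 * (b - a) = b / a - 1 by field; rewrite gt_eqF.
move=> e; rewrite mulNr e; lra.
Qed.

(** With s = sqrt (1 + 4 a), t = sqrt (1 + 4 b) and p = (t - 1) / (s - 1), the gap
    between chi(b) and the tangent at a is
    (t - s)^2 / (2 (s - 1)) + (p - 1 - ln p), a sum of nonnegative terms. *)
Lemma chiR_tangent : tangent_below chiR dchiR.
Proof.
move=> a b a0 b0; rewrite dchiRE // /chiR.
have s1 := sqrt14_gt1 a0; have s2 := sqr_sqrt14 a0.
have t1 := sqrt14_gt1 b0; have t2 := sqr_sqrt14 b0.
move: (Num.sqrt (1 + 4 * a)) (Num.sqrt (1 + 4 * b)) s1 s2 t1 t2 => s t s1 s2 t1 t2.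
have p0 : 0 < s - 1 by lra.
have q0 : 0 < t - 1 by lra.
have := ln_le_sub1 (divr_gt0 q0 p0); rewrite ln_div // => h.
have e : - 2 / (s - 1) * (b - a) =
    - (t - s) ^+ 2 / (2 * (s - 1)) - ((t - 1) / (s - 1) - 1) - (t - s).
  have -> : b = (t ^+ 2 - 1) / 4 by lra.
  have -> : a = (s ^+ 2 - 1) / 4 by lra.
  by field; rewrite gt_eqF.
have : 0 <= (t - s) ^+ 2 / (2 * (s - 1)) by rewrite divr_ge0 ?sqr_ge0 //; lra.
rewrite e mulNr; lra.
Qed.

Variable n : nat.
Implicit Types K : 'M[R]_n.

Lemma tr_mxfun_nln K : posdefmx K -> \tr (mxfun (fun x => - ln x) K) = - ln (\det K).
Proof.
move=> /eigdecP[Ko KE K0]; rewrite [in RHS]KE det_specmx // ln_bigprod //.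
by rewrite /mxfun tr_specmx //= sumrN.
Qed.

Lemma mxfun_oppV K : posdefmx K -> mxfun (fun x => - x^-1) K = - invmx K.
Proof.
move=> /eigdecP[Ko KE K0]; rewrite [in RHS]KE invmx_specmx // /mxfun.
rewrite -scaleN1r specmxZ; apply: eq_specmx => i /=.
by rewrite mulN1r.
Qed.

Lemma mxfun_oppV_cont : mxfun_cont n (fun x : R => - x^-1).
Proof.
move=> T F FF K_ K pK pKx KK; rewrite mxfun_oppV // -scaleN1r => i j.
apply: (@cvg_trans _ ((-1 *: invmx (K_ x)) i j @[x --> F])).
  by apply: near_eq_cvg; apply: filterS pKx => x px; rewrite mxfun_oppV // scaleN1r.
apply: mxcvgZ; apply: mxcvg_inv => //; first exact: posdef_unit.
by apply: filterS pKx => x; exact: posdef_unit.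
Qed.

Let sq (w : R) := Num.sqrt (1 + 4 * w).

Lemma mxfun_sqrt14 K : posdefmx K ->
  [/\ mxfun sq K *m mxfun sq K = 1%:M + 4 *: K &
   forall v : 'cV[R]_n, (v^T *m v) 0 0 <= (v^T *m mxfun sq K *m v) 0 0].
Proof.
move=> /eigdecP[Ko KE K0]; split.
  rewrite [in RHS]KE -(specmx1 Ko) specmxZ specmxD /mxfun specmxM //.
  by apply: eq_specmx => i /=; rewrite -expr2 sqr_sqrt14.
move=> v; have -> : v^T *m v = v^T *m specmx (eigdec K).1 (fun=> 1) *m v.
  by rewrite specmx1 // mulmx1.
rewrite /mxfun !quad_specmx //; apply: ler_sum => i _.
by rewrite ler_wpM2r ?sqr_ge0 //= ltW // sqrt14_gt1.
Qed.

(** From [sqrt_lipschitz]: sqrt (1 + 4 K) is at least 1 because K is positive. *)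
Lemma mxfun_sqrt14_cont : mxfun_cont n sq.
Proof.
move=> T F FF K_ K pK pKx KK i j; apply: cvg_zero.
have c : fnorm2 (4 *: K_ x - 4 *: K) @[x --> F] --> 0.
  have h : fnorm2 (4 *: K_ x - 4 *: K) @[x --> F] --> \sum_(i < n) \sum_(j < n) (0 * 0 : R).
    apply: cvg_bigsum => k _; apply: cvg_bigsum => l _.
    have c0 : (4 *: K_ x - 4 *: K) k l @[x --> F] --> 0.
      have h2 : 4 * K_ x k l - 4 * K k l @[x --> F] --> 4 * K k l - 4 * K k l.
        by apply: cvgB; [apply: cvgM|]; [exact: cvg_cst|exact: KK|exact: cvg_cst].
      by rewrite subrr in h2; under eq_fun do rewrite !mxE.
    by under eq_fun do rewrite expr2; exact: cvgM.
  rewrite (_ : \sum_(i < n) _ = 0) in h => //.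
  by rewrite big1 // => k _; rewrite big1 // => l _; rewrite mulr0.
have c2 : Num.sqrt (fnorm2 (4 *: K_ x - 4 *: K)) @[x --> F] --> 0.
  rewrite -[X in _ --> X]sqrtr0.
  exact: (@cvg_comp _ _ _ _ (@Num.sqrt R) _ _ _ c (@sqrt_continuous R 0)).
apply: norm_cvg0; apply: (squeeze_cvgr _ (cvg_cst 0) c2).
apply: filterS pKx => x px; rewrite normr_ge0 /=.
have [sK cK] := mxfun_sqrt14 pK; have [sx cx] := mxfun_sqrt14 px.
have := sqrt_lipschitz (mxfun_sym sq (K_ x)) (mxfun_sym sq K) cx cK.
rewrite sK sx opprD addrACA subrr add0r => h.
rewrite -sqrtr_sqr ler_wsqrtr //; apply: le_trans h.
by have := fnorm2_ge (mxfun sq (K_ x) - mxfun sq K) i j; rewrite mxE [X in _ + X]mxE.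
Qed.

Lemma mxfun_dchiR K : posdefmx K ->
  mxfun dchiR K = (- 2^-1) *: ((1%:M + mxfun sq K) *m invmx K).
Proof.
move=> /eigdecP[Ko KE K0]; rewrite [in X in invmx X]KE invmx_specmx // -(specmx1 Ko).
rewrite /mxfun specmxD specmxM // specmxZ; apply: eq_specmx => i /=.
by rewrite /dchiR /sq invfM; ring.
Qed.

Lemma mxfun_dchiR_cont : mxfun_cont n dchiR.
Proof.
move=> T F FF K_ K pK pKx KK; rewrite mxfun_dchiR // => i j.
apply: (@cvg_trans _ (((- 2^-1) *: ((1%:M + mxfun sq (K_ x)) *m invmx (K_ x))) i j @[x --> F])).
  by apply: near_eq_cvg; apply: filterS pKx => x px; rewrite mxfun_dchiR.
apply: mxcvgZ; apply: mxcvgM.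
  by apply: mxcvgD; [exact: mxcvg_cst|exact: mxfun_sqrt14_cont].
apply: mxcvg_inv => //; first exact: posdef_unit.
by apply: filterS pKx => x; exact: posdef_unit.
Qed.

(** Each eigenvalue w = (s^2 - 1) / 4 and x = - 2 / (s - 1) satisfy
    x + w x^2 = 1. This is what the choice of chi contributes to the identity
    [hj_algebra]. *)
Lemma mxfun_dchiR_riccati K : posdefmx K ->
  mxfun dchiR K + mxfun dchiR K *m K *m mxfun dchiR K = 1%:M.
Proof.
move=> /eigdecP[Ko KE K0]; rewrite [X in _ *m X *m _]KE /mxfun !specmxM // specmxD.
rewrite -(specmx1 Ko); apply: eq_specmx => i /=; rewrite dchiRE //.
have := sqrt14_gt1 (K0 i); have := sqr_sqrt14 (K0 i).
move: ((eigdec K).2 i) (Num.sqrt _) => w s s2 s1.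
have -> : w = (s ^+ 2 - 1) / 4 by lra.
by field; rewrite gt_eqF //; lra.
Qed.

End ChiReal.

(** * Curves in the complex plane *)

Section ComplexCurves.
Context {R : realType}.
Local Notation C := R[i].
Local Open Scope complex_scope.
Implicit Types (z w : C) (f g : R -> C).

Lemma complex_ext (z w : C) : complex.Re z = complex.Re w -> complex.Im z = complex.Im w -> z = w.
Proof. by case: z w => [a b] [c d] /= -> ->. Qed.

Lemma ReD z w : complex.Re (z + w) = complex.Re z + complex.Re w.
Proof. by case: z w => ? ? []. Qed.

Lemma ImD z w : complex.Im (z + w) = complex.Im z + complex.Im w.
Proof. by case: z w => ? ? []. Qed.

Lemma ReM z w : complex.Re (z * w) = complex.Re z * complex.Re w - complex.Im z * complex.Im w.
Proof. by case: z w => ? ? []. Qed.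

Lemma ImM z w : complex.Im (z * w) = complex.Re z * complex.Im w + complex.Im z * complex.Re w.
Proof. by case: z w => ? ? []. Qed.

Lemma ReV z : complex.Re z^-1 = complex.Re z / (complex.Re z ^+ 2 + complex.Im z ^+ 2).
Proof. by case: z. Qed.

Lemma ImV z : complex.Im z^-1 = - complex.Im z / (complex.Re z ^+ 2 + complex.Im z ^+ 2).
Proof. by case: z => a b; rewrite /= mulNr. Qed.

Lemma cmodM z w : cmod (z * w) = cmod z * cmod w.
Proof.
rewrite /cmod -sqrtrM ?addr_ge0 ?sqr_ge0 //; congr Num.sqrt.
by case: z w => [a b] [c d] /=; ring.
Qed.

Lemma cmod_ge0 z : 0 <= cmod z.
Proof. exact: sqrtr_ge0. Qed.

Lemma sqr_cmod z : cmod z ^+ 2 = complex.Re z ^+ 2 + complex.Im z ^+ 2.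
Proof. by rewrite sqr_sqrtr // addr_ge0 ?sqr_ge0. Qed.

Lemma cmod_normc z : (cmod z)%:C = `|z|.
Proof. by rewrite normc_def. Qed.

Lemma cmodD z w : cmod (z + w) <= cmod z + cmod w.
Proof. by rewrite -lecR raddfD /= !cmod_normc ler_normD. Qed.

Lemma cmodN z : cmod (- z) = cmod z.
Proof. by rewrite /cmod; case: z => a b /=; rewrite !sqrrN. Qed.

Lemma cmodB z w : cmod (z - w) = cmod (w - z).
Proof. by rewrite -cmodN opprB. Qed.

Lemma cmod_eq0 z : (cmod z == 0) = (z == 0).
Proof. by rewrite -(inj_eq (@complexI R)) cmod_normc normr_eq0. Qed.

Lemma cmod_gt0 z : (0 < cmod z) = (z != 0).
Proof. by rewrite lt0r cmod_ge0 andbT cmod_eq0. Qed.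

Lemma cmodR (x : R) : cmod x%:C = `|x|.
Proof. by rewrite /cmod /= expr0n addr0 sqrtr_sqr. Qed.

Lemma cmod1 : cmod (1 : C) = 1.
Proof. by rewrite cmodR normr1. Qed.

Lemma cmodV z : cmod z^-1 = (cmod z)^-1.
Proof.
have [->|z0] := eqVneq z 0.
  have -> : cmod (0 : C) = 0 by apply/eqP; rewrite cmod_eq0.
  by rewrite invr0 invr0; apply/eqP; rewrite cmod_eq0.
have m0 : cmod z != 0 by rewrite cmod_eq0.
by apply: (mulIf m0); rewrite -cmodM !mulVf // cmod1.
Qed.

Lemma cmod_Re z : `|complex.Re z| <= cmod z.
Proof.
by rewrite -sqrtr_sqr ler_wsqrtr // lerDl sqr_ge0.
Qed.

Lemma cmod_Im z : `|complex.Im z| <= cmod z.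
Proof.
by rewrite -sqrtr_sqr ler_wsqrtr // lerDr sqr_ge0.
Qed.

Lemma cmod_subr_le z w : cmod z - cmod w <= cmod (z - w).
Proof. by rewrite lerBlDr; have := cmodD (z - w) w; rewrite subrK. Qed.

Lemma cmod_expi t : cmod (expi t) = 1 :> R.
Proof. by rewrite /cmod /expi /= cos2Dsin2 sqrtr1. Qed.

Lemma cmod_i : cmod ('i%C : C) = 1.
Proof. by rewrite /cmod /= expr0n expr1n add0r sqrtr1. Qed.

(** Derivative of a curve of a real parameter. Holomorphic functions are only
    ever evaluated along such curves, which reduces complex analysis to real
    derivatives of components. *)
Definition is_cderive f (t : R) (f' : C) :=
  is_derive t 1 (fun s => complex.Re (f s)) (complex.Re f') /\
  is_derive t 1 (fun s => complex.Im (f s)) (complex.Im f').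

Lemma is_cderive_eq f t a b : is_cderive f t a -> a = b -> is_cderive f t b.
Proof. by move=> + <-. Qed.

Lemma is_cderive_uniq f t a b : is_cderive f t a -> is_cderive f t b -> a = b.
Proof. by move=> [[_ a1] [_ a2]] [[_ b1] [_ b2]]; apply: complex_ext; rewrite -?a1 -?a2. Qed.

Lemma near_eq_is_cderive f g t a : (\forall s \near t, f s = g s) ->
  is_cderive f t a -> is_cderive g t a.
Proof.
move=> fg [f1 f2]; split.
  by apply: near_eq_is_derive f1; apply: filterS fg => s ->.
by apply: near_eq_is_derive f2; apply: filterS fg => s ->.
Qed.

Lemma is_cderive_cst c t : is_cderive (fun=> c) t 0.
Proof. by split; exact: is_derive_cst. Qed.

Lemma is_cderiveD f g t a b : is_cderive f t a -> is_cderive g t b ->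
  is_cderive (fun s => f s + g s) t (a + b).
Proof.
move=> [f1 f2] [g1 g2]; split.
  by under eq_fun do rewrite ReD; rewrite ReD; exact: is_derive_add.
by under eq_fun do rewrite ImD; rewrite ImD; exact: is_derive_add.
Qed.

Lemma is_cderiveM f g t a b : is_cderive f t a -> is_cderive g t b ->
  is_cderive (fun s => f s * g s) t (a * g t + f t * b).
Proof.
move=> [f1 f2] [g1 g2]; split.
  under eq_fun do rewrite ReM.
  apply: (is_derive_eq (is_derive_sub (is_derive_mul f1 g1) (is_derive_mul f2 g2))).
  by rewrite ReD !ReM; ring.
under eq_fun do rewrite ImM.
apply: (is_derive_eq (is_derive_add (is_derive_mul f1 g2) (is_derive_mul f2 g1))).
by rewrite ImD !ImM; ring.
Qed.

Lemma is_cderiveZ c f t a : is_cderive f t a -> is_cderive (fun s => c * f s) t (c * a).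
Proof.
move=> fa; apply: is_cderive_eq; first exact: is_cderiveM (is_cderive_cst c t) fa.
by rewrite mul0r add0r.
Qed.

Lemma is_cderiveN f t a : is_cderive f t a -> is_cderive (fun s => - f s) t (- a).
Proof.
move=> /(is_cderiveZ (-1)); rewrite mulN1r.
by under [X in is_cderive X]eq_fun do rewrite mulN1r.
Qed.

Lemma is_cderiveB f g t a b : is_cderive f t a -> is_cderive g t b ->
  is_cderive (fun s => f s - g s) t (a - b).
Proof. by move=> fa gb; apply: is_cderiveD => //; exact: is_cderiveN. Qed.

Lemma is_cderive_real (u : R -> R) (t a : R) : is_derive t 1 u a ->
  is_cderive (fun s => (u s)%:C) t a%:C.
Proof. by move=> ua; split => //=; exact: is_derive_cst. Qed.

Lemma is_cderive_cont f t a : is_cderive f t a ->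
  complex.Re (f s) @[s --> t] --> complex.Re (f t) /\
  complex.Im (f s) @[s --> t] --> complex.Im (f t).
Proof.
move=> [[d1 _] [d2 _]]; split.
  by have /derivable1_diffP/differentiable_continuous := d1.
by have /derivable1_diffP/differentiable_continuous := d2.
Qed.

Lemma cvg_cmod f t : complex.Re (f s) @[s --> t] --> complex.Re (f t) ->
  complex.Im (f s) @[s --> t] --> complex.Im (f t) ->
  cmod (f s) @[s --> t] --> cmod (f t).
Proof.
move=> c1 c2; rewrite /cmod.
apply: (@cvg_comp _ _ _ _ (@Num.sqrt R) _ _ _ _ (@sqrt_continuous R _)).
by apply: cvgD; under eq_fun do rewrite expr2; rewrite expr2; exact: cvgM.
Qed.

Lemma is_cderive_ex g (t a b : R) :
  is_derive t 1 (fun s => complex.Re (g s)) a ->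
  is_derive t 1 (fun s => complex.Im (g s)) b ->
  exists c, is_cderive g t c.
Proof. by move=> h1 h2; exists (a +i* b). Qed.

Lemma near_neq0 f t a : is_cderive f t a -> f t != 0 -> \forall s \near t, f s != 0.
Proof.
move=> /is_cderive_cont[c1 c2] f0.
have := cvg_cmod c1 c2; rewrite -cmod_gt0 in f0 => c.
have /(_ (nbhs_filter t)) := @cvgr_gt _ _ (nbhs t) _ _ _ c _ f0.
by apply: filterS => s; rewrite cmod_gt0.
Qed.

(** Existence is read off the components; the value comes from differentiating
    f f^-1 = 1. *)
Lemma is_cderiveV f t a : f t != 0 -> is_cderive f t a ->
  is_cderive (fun s => (f s)^-1) t (- a / f t ^+ 2).
Proof.
move=> f0 fa; have [d1 d2] := fa.
have n0 : complex.Re (f t) ^+ 2 + complex.Im (f t) ^+ 2 != 0.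
  by rewrite -sqr_cmod expf_eq0 /= cmod_eq0.
have dn := @is_derive_inv _ (fun s => complex.Re (f s) * complex.Re (f s) +
  complex.Im (f s) * complex.Im (f s)) _ _ n0
  (is_derive_add (is_derive_mul d1 d1) (is_derive_mul d2 d2)).
have [b fb] : exists b, is_cderive (fun s => (f s)^-1) t b.
  apply: is_cderive_ex.
    by under eq_fun do rewrite ReV; exact: is_derive_mul d1 dn.
  by under eq_fun do rewrite ImV; exact: is_derive_mul (is_derive_opp d2) dn.
apply: (is_cderive_eq fb).
have f1 : \forall s \near t, 1 = f s * (f s)^-1.
  by have := near_neq0 fa f0; apply: filterS => s s0; rewrite mulfV.
have := is_cderive_uniq (is_cderiveM fa fb) (near_eq_is_cderive f1 (is_cderive_cst 1 t)).
rewrite addrC => /eqP; rewrite addr_eq0 => /eqP e.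
by apply: (mulfI f0); rewrite e; field.
Qed.

Lemma is_derive_cmod f t a : f t != 0 -> is_cderive f t a ->
  is_derive t 1 (fun s => cmod (f s))
    ((complex.Re (f t) * complex.Re a + complex.Im (f t) * complex.Im a) / cmod (f t)).
Proof.
move=> f0 [d1 d2].
pose v s := complex.Re (f s) * complex.Re (f s) + complex.Im (f s) * complex.Im (f s).
have v0 : 0 < v t by rewrite /v -!expr2 -sqr_cmod exprn_gt0 // cmod_gt0.
have dv := is_derive_add (is_derive_mul d1 d1) (is_derive_mul d2 d2).
apply: (is_derive_eq (is_derive_comp (is_derive1_sqrt v0) dv)); rewrite /cmod -/(v t).
have : Num.sqrt (v t) != 0 by rewrite gt_eqF // sqrtr_gt0.
by move: (Num.sqrt _) => q q0; field.
Qed.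

(** * Principal branches on the slit plane *)

(** The quantity |z| + Re z vanishes exactly on the cut. This turns the slit
    plane into a single strict inequality and gives the denominator of the
    half-angle formula. *)
Lemma slit_planeP z : slit_plane z <-> 0 < cmod z + complex.Re z.
Proof.
split=> [zs|S0 [y0 x0]]; last first.
  by move: S0; rewrite /cmod y0 expr0n addr0 sqrtr_sqr ler0_norm // addNr ltxx.
rewrite ltNge; apply/negP => h; apply: zs => /=.
have := cmod_Re z; have := sqr_cmod z; have := cmod_ge0 z.
rewrite ler_norml; move: (cmod z) h => r h r0 e /andP[h1 h2].
have rx : r = - complex.Re z by lra.
split; last by lra.
apply/eqP; rewrite -sqrf_eq0; apply/eqP; move: e; rewrite rx sqrrN; lra.
Qed.

Lemma slit_neq0 z : slit_plane z -> z != 0.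
Proof. by move=> zs; apply/eqP => z0; apply: zs; rewrite z0 /=. Qed.

(** Off the cut, half the argument of z is the arctangent of
    Im z / (|z| + Re z). *)
Lemma slit_half_angle z : slit_plane z ->
  let S := cmod z + complex.Re z in let u := complex.Im z / S in
  [/\ 0 < cos (atan u), cos (atan u) ^+ 2 = S / (2 * cmod z) & sin (atan u) = u * cos (atan u)].
Proof.
move=> zs S u; have S0 : 0 < S by apply/slit_planeP.
have r0 : 0 < cmod z by rewrite cmod_gt0 slit_neq0.
have c0 : 0 < cos (atan u).
  by rewrite cos_gt0_pihalf // atan_gtNpi2 atan_ltpi2.
split=> //.
  rewrite cos_atan exprVn sqr_sqrtr ?addr_ge0 ?sqr_ge0 //.
  have y2 : complex.Im z ^+ 2 = (cmod z - complex.Re z) * S.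
    by rewrite /S; have := sqr_cmod z; lra.
  have -> : 1 + u ^+ 2 = 2 * cmod z / S.
    by rewrite /u expr_div_n y2 /S; field; rewrite (gt_eqF S0).
  by rewrite invf_div.
by have := atanK u; rewrite /tan => h; rewrite -{2}h divfK // gt_eqF.
Qed.

(** Unlike the formula with acos, whose derivative is singular on the positive
    real axis, this one is visibly smooth on the whole slit plane. *)
Lemma carg_slit z : slit_plane z ->
  carg z = 2 * atan (complex.Im z / (cmod z + complex.Re z)).
Proof.
move=> zs; have [c0 c2 s1] := slit_half_angle zs.
have S0 : 0 < cmod z + complex.Re z by apply/slit_planeP.
have r0 : 0 < cmod z by rewrite cmod_gt0 slit_neq0.
have y2 : complex.Im z ^+ 2 = (cmod z - complex.Re z) * (cmod z + complex.Re z).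
  by have := sqr_cmod z; lra.
set u := _ / _ in c0 c2 s1 *.
have cE : cos (2 * atan u) = complex.Re z / cmod z.
  rewrite mulr_natl mulr2n cosD s1 mulrACA -!expr2 c2 /u expr_div_n y2.
  by field; rewrite !gt_eqF.
have al := atan_ltpi2 u; have ag := atan_gtNpi2 u.
rewrite /carg -cE; case: ifPn => y0.
  have u0 : 0 <= atan u by rewrite -[leLHS]atan0 le_atan // /u divr_ge0 // ltW.
  rewrite cosK // in_itv /=; apply/andP; split; lra.
have u0 : atan u < 0.
  by rewrite -[ltRHS]atan0 lt_atan // /u pmulr_llt0 ?invr_gt0 // ltNge.
rewrite cosKN ?opprK //; apply/andP; split; lra.
Qed.

Lemma csqrt_slit z : slit_plane z ->
  let u := complex.Im z / (cmod z + complex.Re z) in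
  csqrt z = (Num.sqrt (cmod z) * cos (atan u)) +i* (Num.sqrt (cmod z) * sin (atan u)).
Proof.
move=> zs u; rewrite /csqrt carg_slit // mulrAC divff ?mul1r ?pnatr_eq0 //.
by apply: complex_ext; rewrite ?ReM ?ImM /=; ring.
Qed.

Lemma sqr_csqrt z : slit_plane z -> csqrt z ^+ 2 = z.
Proof.
move=> zs; rewrite csqrt_slit //=; have [c0 c2 s1] := slit_half_angle zs.
have S0 : 0 < cmod z + complex.Re z by apply/slit_planeP.
have r0 : 0 < cmod z by rewrite cmod_gt0 slit_neq0.
have y2 : complex.Im z ^+ 2 = (cmod z - complex.Re z) * (cmod z + complex.Re z).
  by have := sqr_cmod z; lra.
have q2 : Num.sqrt (cmod z) ^+ 2 = cmod z by rewrite sqr_sqrtr // ltW.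
set u := _ / _ in c0 c2 s1 *; move: (Num.sqrt _) q2 => q q2.
rewrite s1 expr2; apply: complex_ext; rewrite ?ReM ?ImM /=.
  have -> : q * cos (atan u) * (q * cos (atan u)) -
     q * (u * cos (atan u)) * (q * (u * cos (atan u))) =
     q ^+ 2 * cos (atan u) ^+ 2 * (1 - u ^+ 2) by ring.
  by rewrite q2 c2 /u expr_div_n y2; field; rewrite !gt_eqF.
have -> : q * cos (atan u) * (q * (u * cos (atan u))) +
   q * (u * cos (atan u)) * (q * cos (atan u)) = q ^+ 2 * cos (atan u) ^+ 2 * (2 * u) by ring.
by rewrite q2 c2 /u; field; rewrite !gt_eqF.
Qed.

Lemma Re_csqrt_gt0 z : slit_plane z -> 0 < complex.Re (csqrt z).
Proof.
move=> zs; rewrite csqrt_slit //=; have [c0 _ _] := slit_half_angle zs.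
by rewrite mulr_gt0 // sqrtr_gt0 cmod_gt0 slit_neq0.
Qed.

Lemma near_slit f t a : is_cderive f t a -> slit_plane (f t) ->
  \forall s \near t, slit_plane (f s).
Proof.
move=> /is_cderive_cont[c1 c2] /slit_planeP S0.
have c : cmod (f s) + complex.Re (f s) @[s --> t] --> cmod (f t) + complex.Re (f t).
  by apply: cvgD => //; exact: cvg_cmod.
have /(_ (nbhs_filter t)) := @cvgr_gt _ _ (nbhs t) _ _ _ c _ S0.
by apply: filterS => s /slit_planeP.
Qed.

(** Complex differentiability of g at z with derivative d, stated as the chain
    rule along curves; it composes by definition. *)
Definition cdiff (g : C -> C) z d := forall f t a, f t = z ->
  is_cderive f t a -> is_cderive (fun s => g (f s)) t (d * a).

Lemma is_derive_half_tan f t a : is_cderive f t a -> slit_plane (f t) ->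
  is_derive t 1 (fun s => complex.Im (f s) / (cmod (f s) + complex.Re (f s)))
    ((complex.Re (f t) * complex.Im a - complex.Im (f t) * complex.Re a)
      / (cmod (f t) * (cmod (f t) + complex.Re (f t)))).
Proof.
move=> fa fs; have f0 := slit_neq0 fs; have [d1 d2] := fa.
have S0 : 0 < cmod (f t) + complex.Re (f t) by apply/slit_planeP.
have r0 : 0 < cmod (f t) by rewrite cmod_gt0 slit_neq0.
have dS := is_derive_add (is_derive_cmod f0 fa) d1.
have dV := @is_derive_inv _ (fun s => cmod (f s) + complex.Re (f s)) _ _ (lt0r_neq0 S0) dS.
apply: (is_derive_eq (is_derive_mul d2 dV)).
have y2 : complex.Im (f t) ^+ 2 = (cmod (f t) - complex.Re (f t)) * (cmod (f t) + complex.Re (f t)).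
  by have := sqr_cmod (f t); lra.
move: (cmod (f t)) (complex.Re (f t)) (complex.Im (f t)) (complex.Re a) (complex.Im a) y2 S0 r0.
move=> r x y x' y' y2 S0 r0.
apply/eqP; rewrite -subr_eq0; apply/eqP.
have -> : y' / (r + x) + y * (- (r + x) ^- 2 * ((x * x' + y * y') / r + x')) -
   (x * y' - y * x') / (r * (r + x)) =
   y' * ((r - x) * (r + x) - y ^+ 2) / (r * (r + x) ^+ 2).
  by field; rewrite !gt_eqF.
by rewrite y2 subrr mulr0 mul0r.
Qed.

(** The half-angle formula shows that the root is differentiable along curves;
    differentiating its square, which is the identity, gives the value. *)
Lemma csqrt_cdiff z : slit_plane z -> cdiff csqrt z (2 * csqrt z)^-1.
Proof.
move=> zs f t a ftz fa; rewrite -ftz in zs *.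
have fs := near_slit fa zs.
have r0 : 0 < cmod (f t) by rewrite cmod_gt0 slit_neq0.
have dq := @is_derive_comp _ _ (fun s => cmod (f s)) _ _ _ (is_derive1_sqrt r0)
  (is_derive_cmod (slit_neq0 zs) fa).
have da := @is_derive_comp _ _ (fun s => complex.Im (f s) / (cmod (f s) + complex.Re (f s)))
  _ _ _ (is_derive1_atan _) (is_derive_half_tan fa zs).
pose al s := atan (complex.Im (f s) / (cmod (f s) + complex.Re (f s))).
have [b gb] : exists b, is_cderive (fun s => csqrt (f s)) t b.
  pose g s : C := let u := complex.Im (f s) / (cmod (f s) + complex.Re (f s)) in
    (Num.sqrt (cmod (f s)) * cos (atan u)) +i* (Num.sqrt (cmod (f s)) * sin (atan u)).
  have [b gb] : exists b, is_cderive g t b.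
    have dc := @is_derive_comp _ (@cos R) al _ _ _ (is_derive_cos _) da.
    have ds := @is_derive_comp _ (@sin R) al _ _ _ (is_derive_sin _) da.
    exact: (@is_cderive_ex g _ _ _ (is_derive_mul dq dc) (is_derive_mul dq ds)).
  by exists b; apply: near_eq_is_cderive gb; apply: filterS fs => s ss; rewrite csqrt_slit.
apply: (is_cderive_eq gb).
have sq : \forall s \near t, f s = csqrt (f s) ^+ 2.
  by apply: filterS fs => s ss; rewrite sqr_csqrt.
have e := is_cderive_uniq (is_cderiveM gb gb) (near_eq_is_cderive sq fa).
have q0 : csqrt (f t) != 0.
  by apply/eqP => h; have := Re_csqrt_gt0 zs; rewrite h /= ltxx.
rewrite -e; field; exact: q0.
Qed.

Lemma cln_cdiff z : slit_plane z -> cdiff cln z z^-1.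
Proof.
move=> zs f t a ftz fa; rewrite -ftz in zs *.
have fs := near_slit fa zs.
have r0 : 0 < cmod (f t) by rewrite cmod_gt0 slit_neq0.
have S0 : 0 < cmod (f t) + complex.Re (f t) by apply/slit_planeP.
have [c0 c2 s1] := slit_half_angle zs.
have dl := @is_derive_comp _ _ (fun s => cmod (f s)) _ _ _ (is_derive1_ln r0)
  (is_derive_cmod (slit_neq0 zs) fa).
have da := @is_derive_comp _ _ (fun s => complex.Im (f s) / (cmod (f s) + complex.Re (f s)))
  _ _ _ (is_derive1_atan _) (is_derive_half_tan fa zs).
split => /=.
  apply: (is_derive_eq dl).
  by rewrite ReM ReV ImV -sqr_cmod; field; rewrite gt_eqF.
apply: (@near_eq_is_derive _ _ _
    (fun s => 2 * atan (complex.Im (f s) / (cmod (f s) + complex.Re (f s))))).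
  by apply: filterS fs => s ss; rewrite carg_slit.
apply: (is_derive_eq (is_derive_scal 2 da)).
rewrite ImM ReV ImV -sqr_cmod.
move: c2; rewrite cos_atan exprVn sqr_sqrtr ?addr_ge0 ?sqr_ge0 // => ->.
by field; rewrite !gt_eqF.
Qed.

Definition dchi (w : C) : C := - 2 / (csqrt (1 + 4 * w) - 1).

Lemma Re_1D4 w : complex.Re (1 + 4 * w) = 1 + 4 * complex.Re w.
Proof. by case: w => a b /=; simpc; ring. Qed.

Lemma Im_1D4 w : complex.Im (1 + 4 * w) = 4 * complex.Im w.
Proof. by case: w => a b /=; simpc; ring. Qed.

Lemma slit_1D4 w : slit_plane w -> slit_plane (1 + 4 * w).
Proof. by move=> ws []; rewrite Re_1D4 Im_1D4 => h1 h2; apply: ws => /=; split; lra. Qed.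

(** The logarithm in chi stays off its cut: if s - 1 <= 0 where s is the root of
    1 + 4 w, then s lies in ]0, 1] and w = (s^2 - 1) / 4 is on the cut. *)
Lemma csqrt_sub1_slit w : slit_plane w -> slit_plane (csqrt (1 + 4 * w) - 1).
Proof.
move=> ws; have vs := slit_1D4 ws; have s0 := Re_csqrt_gt0 vs; have s2 := sqr_csqrt vs.
move: (csqrt _) s0 s2 => s s0 s2 [h1 h2]; apply: ws => /=.
have i0 : complex.Im s = 0 by move: h1; case: (s) => a b /=; rewrite subr0.
have r1 : complex.Re s <= 1 by move: h2; case: (s) => a b /=; rewrite subr_le0.
have f1 := congr1 (@complex.Re R) s2; have f2 := congr1 (@complex.Im R) s2.
rewrite expr2 ReM Re_1D4 i0 in f1; rewrite expr2 ImM Im_1D4 i0 in f2.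
split; first by lra.
by nra.
Qed.

Lemma chi_cdiff w : slit_plane w -> cdiff (@chi R) w (dchi w).
Proof.
move=> ws f t a ftw fa; rewrite -ftw in ws *.
have vs := slit_1D4 ws; have us := csqrt_sub1_slit ws.
have d4 : is_cderive (fun s => 1 + 4 * f s) t (4 * a).
  apply: (is_cderive_eq (is_cderiveD (is_cderive_cst 1 t) (is_cderiveZ 4 fa))).
  by rewrite add0r.
have dsq := csqrt_cdiff vs (erefl _) d4.
have du : is_cderive (fun s => csqrt (1 + 4 * f s) - 1) t
    ((2 * csqrt (1 + 4 * f t))^-1 * (4 * a)).
  by apply: (is_cderive_eq (is_cderiveB dsq (is_cderive_cst 1 t))); rewrite subr0.
have dl := cln_cdiff us (erefl _) du.
apply: (is_cderive_eq (is_cderiveB (is_cderiveN dsq) dl)).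
have s0 : csqrt (1 + 4 * f t) != 0.
  by apply/eqP => h; have := Re_csqrt_gt0 vs; rewrite h /= ltxx.
have u0 := slit_neq0 us.
by rewrite /dchi; field; rewrite s0 u0.
Qed.

Lemma dchi_derivable f t a : is_cderive f t a -> slit_plane (f t) ->
  exists b, is_cderive (fun s => dchi (f s)) t b.
Proof.
move=> fa ws; have vs := slit_1D4 ws; have us := csqrt_sub1_slit ws.
have d4 := is_cderiveD (is_cderive_cst 1 t) (is_cderiveZ 4 fa).
have dsq := csqrt_cdiff vs (erefl _) d4.
have du := is_cderiveB dsq (is_cderive_cst 1 t).
have dv := is_cderiveV (slit_neq0 us) du.
by eexists; exact: is_cderiveZ dv.
Qed.

(** Rationalising, chi'(w) = - (1 + sqrt (1 + 4 w)) / (2 w): a bound through |w|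
    alone, used to dominate the derivative under the integral sign. *)
Lemma dchi_bound w : slit_plane w ->
  cmod (dchi w) <= (1 + Num.sqrt (1 + 4 * cmod w)) / (2 * cmod w).
Proof.
move=> ws; have vs := slit_1D4 ws; have us := csqrt_sub1_slit ws.
have w0 := slit_neq0 ws; have u0 := slit_neq0 us.
have -> : dchi w = - (1 + csqrt (1 + 4 * w)) / (2 * w).
  have s2 := sqr_csqrt vs; rewrite /dchi.
  have e : 4 * w = (csqrt (1 + 4 * w) - 1) * (csqrt (1 + 4 * w) + 1).
    by rewrite -subr_sqr expr1n s2 addrC addKr.
  move: (csqrt _) e u0 => s e u0.
  have -> : w = (s - 1) * (s + 1) / 4 by rewrite -e; field.
  have p0 : s + 1 != 0.
    apply/eqP => h; case/eqP: w0; apply/eqP; have /eqP : 4 * w = 0 by rewrite e h mulr0.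
    by rewrite mulf_eq0 pnatr_eq0.
  by field; rewrite p0 u0.
have c2 : cmod (2 : C) = 2 by rewrite -[2]/(2%:R) -(rmorph_nat (@real_complex R)) cmodR normr_nat.
have c4 : cmod (4 : C) = 4 by rewrite -[4]/(4%:R) -(rmorph_nat (@real_complex R)) cmodR normr_nat.
have cw : 0 < cmod w by rewrite cmod_gt0.
rewrite cmodM cmodV cmodN cmodM c2 ler_wpM2r ?invr_ge0 ?mulr_ge0 ?cmod_ge0 //.
apply: le_trans (cmodD _ _) _; rewrite cmod1 lerD2l.
rewrite -[leLHS]ger0_norm ?cmod_ge0 // -sqrtr_sqr ler_wsqrtr //.
rewrite expr2 -cmodM -expr2 sqr_csqrt //.
by apply: le_trans (cmodD _ _) _; rewrite cmod1 cmodM c4.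
Qed.

Lemma csqrt_real (b : R) : 0 < b -> csqrt b%:C = (Num.sqrt b)%:C.
Proof.
move=> b0; rewrite /csqrt /carg /= lexx cmodR gtr0_norm // divff ?gt_eqF // acos1 mul0r.
by rewrite /expi cos0 sin0 mulr1.
Qed.

Lemma cln_real (b : R) : 0 < b -> cln b%:C = (ln b)%:C.
Proof.
by move=> b0; rewrite /cln /carg /= lexx cmodR gtr0_norm // divff ?gt_eqF // acos1.
Qed.

Lemma chi_real (b : R) : 0 < b -> chi b%:C = (chiR b)%:C.
Proof.
move=> b0; have s1 := sqrt14_gt1 b0.
have e : 1 + 4 * b%:C = (1 + 4 * b)%:C :> C.
  by rewrite rmorphD rmorphM /= rmorph_nat rmorph1.
have b1 : 0 < 1 + 4 * b by lra.
have h : (Num.sqrt (1 + 4 * b))%:C - 1 = (Num.sqrt (1 + 4 * b) - 1)%:C :> C.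
  by rewrite rmorphB rmorph1.
by rewrite /chi e csqrt_real // h cln_real ?subr_gt0 // /chiR rmorphB rmorphN.
Qed.

End ComplexCurves.

(** * Cauchy's formula for chi on a circle *)

Section CauchyFormula.
Context {R : realType}.
Local Notation C := R[i].
Local Open Scope complex_scope.
Local Notation mu := (@lebesgue_measure R).
Local Notation I := (`[0, 2 * pi]%classic : set R).
Implicit Types (z w : C) (f g : R -> C).

Lemma twopi_gt0 : 0 < 2 * pi :> R.
Proof. by rewrite mulr_gt0 // pi_gt0. Qed.

Lemma continuous_integrable_itv (a b : R) (u : R -> R) :
  continuous u -> mu.-integrable `[a, b] (EFin \o u).
Proof.
move=> cu; apply: continuous_compact_integrable; first exact: segment_compact.
exact: continuous_subspaceT.
Qed.

Lemma is_derive_continuous (u du : R -> R) : (forall t : R, is_derive t 1 u (du t)) -> continuous u.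
Proof.
by move=> d t; have [/derivable1_diffP/differentiable_continuous] := d t.
Qed.

Lemma Rintegral_FTC (a b : R) (U u : R -> R) : a < b -> continuous u ->
  (forall t : R, is_derive t 1 U (u t)) ->
  \int[mu]_(t in `[a, b]) u t = U b - U a.
Proof.
move=> ab cu dU; have cU := is_derive_continuous dU.
rewrite /Rintegral (@continuous_FTC2 _ u U a b ab) //.
- exact: continuous_subspaceT.
- split; first by move=> x _; have [] := dU x.
    exact/cvg_at_right_filter/cU.
  exact/cvg_at_left_filter/cU.
- by move=> x _; rewrite derive1E; have [] := dU x.
Qed.

(** Homotopy invariance of contour integrals in parametric form: if the
    derivative of g in the parameter is also the derivative in t of a function
    H that takes the same value at both ends, then it integrates to 0. *)
Lemma Rintegral_family_cst (g dg H : R -> R -> R) (B : R) :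
  (forall x t : R, is_derive x 1 (g^~ t) (dg x t)) -> (forall x, continuous (g x)) ->
  (forall x t, `|dg x t| <= B) -> (forall x, continuous (dg x)) ->
  (forall x t : R, is_derive t 1 (H x) (dg x t)) -> (forall x, H x (2 * pi) = H x 0) ->
  forall x y, \int[mu]_(t in I) g x t = \int[mu]_(t in I) g y t.
Proof.
move=> dgP cg dgB cdg HP Hper x0 y0.
apply: (@is_derive_0_is_cst _ (fun x => \int[mu]_(t in I) g x t) x0 y0) => x.
have dgE a t : partial1of2 g a t = dg a t.
  by rewrite partial1of2E; have [] := dgP a t.
have xI : `]x - 1, x + 1[%classic x by rewrite /= in_itv /=; apply/andP; split; lra.
have intg a : `]x - 1, x + 1[%classic a -> mu.-integrable I (EFin \o g a).
  by move=> _; exact: continuous_integrable_itv.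
have derg a t : `]x - 1, x + 1[%classic a -> I t -> derivable (g^~ t) a 1.
  by move=> _ _; have [] := dgP a t.
have B0 : 0 <= B by exact: le_trans (dgB 0 0).
have intB : mu.-integrable I (EFin \o (fun=> B)).
  by apply: continuous_integrable_itv => t; exact: cvg_cst.
have ub a t : `]x - 1, x + 1[%classic a -> I t -> `|partial1of2 g a t| <= B.
  by move=> _ _; rewrite dgE.
apply: DeriveDef.
  exact: (@derivable_under_integral _ _ _ mu g _ (measurable_itv _)
    _ _ _ xI intg derg _ (fun=> B0) intB ub).
rewrite -derive1E (@differentiation_under_integral _ _ _ mu g _ (measurable_itv _)
  _ _ _ xI intg derg _ (fun=> B0) intB ub).
rewrite (_ : partial1of2 g x = dg x); last by apply/funext => t; exact: dgE.
by rewrite (Rintegral_FTC twopi_gt0 (cdg x) (HP x)) Hper subrr.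
Qed.

Definition ccont f :=
  continuous (fun t => complex.Re (f t)) /\ continuous (fun t => complex.Im (f t)).

Lemma cderive_ccont f : (forall t, exists a, is_cderive f t a) -> ccont f.
Proof.
by move=> df; split=> t; have [a /is_cderive_cont[]] := df t.
Qed.

Lemma Cintegral_family_cst (g dg H : R -> R -> C) (B : R) :
  (forall x t, is_cderive (g^~ t) x (dg x t)) -> (forall x, ccont (g x)) ->
  (forall x t, cmod (dg x t) <= B) -> (forall x, ccont (dg x)) ->
  (forall x t, is_cderive (H x) t (dg x t)) -> (forall x, H x (2 * pi) = H x 0) ->
  forall x y, Cintegral I (g x) = Cintegral I (g y).
Proof.
move=> dgP cg dgB cdg HP Hper x y; rewrite /Cintegral; congr (_ +i* _).
  apply: (@Rintegral_family_cst (fun x t => complex.Re (g x t)) (fun x t => complex.Re (dg x t))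
    (fun x t => complex.Re (H x t)) B) => //.
  - by move=> a t; have [] := dgP a t.
  - by move=> a; have [] := cg a.
  - by move=> a t; apply: le_trans (cmod_Re _) _.
  - by move=> a; have [] := cdg a.
  - by move=> a t; have [] := HP a t.
  - by move=> a; rewrite Hper.
apply: (@Rintegral_family_cst (fun x t => complex.Im (g x t)) (fun x t => complex.Im (dg x t))
  (fun x t => complex.Im (H x t)) B) => //.
- by move=> a t; have [] := dgP a t.
- by move=> a; have [] := cg a.
- by move=> a t; apply: le_trans (cmod_Im _) _.
- by move=> a; have [] := cdg a.
- by move=> a t; have [] := HP a t.
- by move=> a; rewrite Hper.
Qed.

Lemma CintegralD f g : ccont f -> ccont g ->
  Cintegral I (fun t => f t + g t) = Cintegral I f + Cintegral I g.
Proof.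
move=> [f1 f2] [g1 g2]; rewrite /Cintegral.
apply: complex_ext => /=.
  rewrite -RintegralD //; try exact: continuous_integrable_itv.
  by apply: eq_Rintegral => t _; rewrite ReD.
rewrite -RintegralD //; try exact: continuous_integrable_itv.
by apply: eq_Rintegral => t _; rewrite ImD.
Qed.

Lemma CintegralZ c f : ccont f ->
  Cintegral I (fun t => c * f t) = c * Cintegral I f.
Proof.
move=> [f1 f2]; rewrite /Cintegral; have mI : measurable I by exact: measurable_itv.
have i1 := continuous_integrable_itv 0 (2 * pi) f1.
have i2 := continuous_integrable_itv 0 (2 * pi) f2.
have cZ (k : R) (u : R -> R) : continuous u -> continuous (fun t => k * u t).
  by move=> cu t; apply: cvgM; [exact: cvg_cst|exact: cu].
apply: complex_ext; rewrite ?ReM ?ImM /=.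
  rewrite -!RintegralZl // -RintegralB //; try exact/continuous_integrable_itv/cZ.
  by apply: eq_Rintegral => t _; rewrite ReM.
rewrite -!RintegralZl // -RintegralD //; try exact/continuous_integrable_itv/cZ.
by apply: eq_Rintegral => t _; rewrite ImM.
Qed.

Lemma ccontD f g : ccont f -> ccont g -> ccont (fun t => f t + g t).
Proof.
move=> [f1 f2] [g1 g2]; split=> t.
  by under eq_fun do rewrite ReD; exact: cvgD (f1 t) (g1 t).
by under eq_fun do rewrite ImD; exact: cvgD (f2 t) (g2 t).
Qed.

Lemma ccontM f g : ccont f -> ccont g -> ccont (fun t => f t * g t).
Proof.
move=> [f1 f2] [g1 g2]; split=> t.
  under eq_fun do rewrite ReM.
  apply: cvgB; first exact: cvgM (f1 t) (g1 t).
  exact: cvgM (f2 t) (g2 t).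
under eq_fun do rewrite ImM.
apply: cvgD; first exact: cvgM (f1 t) (g2 t).
exact: cvgM (f2 t) (g1 t).
Qed.

Lemma ccont_cst c : ccont (fun=> c).
Proof. by split=> t; exact: cvg_cst. Qed.

Lemma Cintegral_sum (J : Type) (r : seq J) (F : J -> R -> C) : (forall j, ccont (F j)) ->
  Cintegral I (fun t => \sum_(j <- r) F j t) = \sum_(j <- r) Cintegral I (F j).
Proof.
move=> cF.
suff [] : ccont (fun t => \sum_(j <- r) F j t) /\
  Cintegral I (fun t => \sum_(j <- r) F j t) = \sum_(j <- r) Cintegral I (F j) by [].
elim: r => [|j r [cr IH]].
  rewrite big_nil; under eq_fun do rewrite big_nil; split; first exact: ccont_cst.
  by have e := CintegralZ 0 (ccont_cst 0); rewrite mul0r in e; rewrite e mul0r.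
rewrite big_cons; under eq_fun do rewrite big_cons; split; first exact: ccontD.
by rewrite CintegralD // IH.
Qed.

Lemma is_cderive_expi t : is_cderive (@expi R) t ('i%C * expi t).
Proof.
split; rewrite ?ReM ?ImM /=.
  by apply: (is_derive_eq (is_derive_cos t)); ring.
by apply: (is_derive_eq (is_derive_sin t)); ring.
Qed.

Lemma expi_2pi : expi (2 * pi) = 1 :> C.
Proof. by rewrite /expi mulr_natl cos2pi sin2pi. Qed.

Lemma expi_0 : expi 0 = 1 :> C.
Proof. by rewrite /expi cos0 sin0. Qed.

Lemma Cintegral1 : Cintegral I (fun=> 1) = (2 * pi)%:C.
Proof.
rewrite /Cintegral /= (@Rintegral_FTC _ _ id) ?twopi_gt0 //; last by move=> t; exact: cvg_cst.
rewrite (@Rintegral_FTC _ _ (cst 0)) ?twopi_gt0 ?subrr ?subr0 //.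
by move=> t; exact: cvg_cst.
Qed.

Section Circle.
Variables (c : C) (r : R).
Hypothesis r0 : 0 < r.

Let gam t : C := c + r%:C * expi t.
Let dgam t : C := 'i%C * r%:C * expi t.

Lemma gam_cderive t : is_cderive gam t (dgam t).
Proof.
apply: (is_cderive_eq (is_cderiveD (is_cderive_cst c t) (is_cderiveZ r%:C (is_cderive_expi t)))).
by rewrite add0r mulrCA mulrA.
Qed.

Lemma dgam_ccont : ccont dgam.
Proof. by apply: cderive_ccont => t; eexists; exact: is_cderiveZ (is_cderive_expi t). Qed.

Lemma gam_per : gam (2 * pi) = gam 0.
Proof. by rewrite /gam expi_2pi expi_0. Qed.

Lemma cmod_gam t : cmod (gam t - c) = r.
Proof. by rewrite /gam addrC addKr cmodM cmod_expi mulr1 cmodR gtr0_norm. Qed.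

Lemma cmod_dgam t : cmod (dgam t) = r.
Proof. by rewrite /dgam !cmodM cmod_i cmod_expi mul1r mulr1 cmodR gtr0_norm. Qed.

(** A homotopy parameter defined for all real x, which stays in [0, 1], equals 0 at
    0 and 1 at pi, and whose derivative vanishes wherever it does. *)
Definition bump (x : R) : R := (1 - cos x) / 2.

Lemma bump_derive (x : R) : is_derive x 1 bump (sin x / 2).
Proof.
have d1 : is_derive x 1 (fun=> 1 : R) 0 by exact: is_derive_cst.
have d2 := is_derive_scal 2^-1 (is_derive_sub d1 (is_derive_cos x)).
rewrite /bump; under eq_fun do rewrite mulrC.
by apply: (is_derive_eq d2); ring.
Qed.

Lemma bump_01 x : 0 <= bump x <= 1.
Proof.
rewrite /bump; have := cos_le1 x; have := cos_geN1 x => h1 h2.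
by apply/andP; split; lra.
Qed.

Lemma dbump_le (x : R) : `|sin x / 2| <= 1.
Proof.
rewrite ler_norml; have := sin_le1 x; have := sin_geN1 x => h1 h2.
by apply/andP; split; lra.
Qed.

Lemma bump_eq0 x : bump x = 0 -> sin x = 0.
Proof.
rewrite /bump => b0; have c1 : cos x = 1 by lra.
by apply/eqP; rewrite -sqrf_eq0; apply/eqP; have := cos2Dsin2 x; rewrite c1; lra.
Qed.

Lemma bump0 : bump 0 = 0.
Proof. by rewrite /bump cos0 subrr mul0r. Qed.

Lemma bumppi : bump pi = 1.
Proof. by rewrite /bump cospi; lra. Qed.

Variable om : C.
Hypothesis omc : cmod (om - c) < r.

Lemma gam_neq t : gam t - om != 0.
Proof.
apply/eqP => h; have : gam t - c = om - c by rewrite -[gam t](subrK om) h add0r.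
move=> /(congr1 (@cmod R)); rewrite cmod_gam => e; move: omc; by rewrite -e ltxx.
Qed.

(** Moving om to the centre c along the segment, parametrised by [bump], keeps it
    away from the circle; the derivative in the parameter is the derivative in t
    of a multiple of 1 / (gam - om). At the centre the integrand is the constant
    i. *)
Lemma winding : Cintegral I (fun t => dgam t / (gam t - om)) = (2 * pi)%:C * 'i%C.
Proof.
pose omx x := c + (bump x)%:C * (om - c).
have omxc x : cmod (omx x - c) <= cmod (om - c).
  rewrite /omx addrC addKr cmodM cmodR; have /andP[b0 b1] := bump_01 x.
  by rewrite ger0_norm // ler_piMl // cmod_ge0.
pose m := r - cmod (om - c); have m0 : 0 < m by rewrite subr_gt0.
have gm x t : m <= cmod (gam t - omx x).
  have -> : gam t - omx x = (gam t - c) - (omx x - c) by rewrite opprB addrA subrK.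
  by apply: le_trans (cmod_subr_le _ _); rewrite cmod_gam /m lerD2l lerN2.
have gn x t : gam t - omx x != 0 by rewrite -cmod_gt0 (lt_le_trans m0).
have domx x : is_cderive omx x ((sin x / 2)%:C * (om - c)).
  have h := is_cderiveM (is_cderive_real (bump_derive x)) (is_cderive_cst (om - c) x).
  apply: (is_cderive_eq (is_cderiveD (is_cderive_cst c x) h)).
  by rewrite mulr0 addr0 add0r.
pose g x t := dgam t / (gam t - omx x).
pose dg x t := dgam t * ((sin x / 2)%:C * (om - c)) / (gam t - omx x) ^+ 2.
pose H x t := - ((sin x / 2)%:C * (om - c)) / (gam t - omx x).
have dgt x t : is_cderive (fun t => gam t - omx x) t (dgam t).
  by apply: (is_cderive_eq (is_cderiveB (gam_cderive t) (is_cderive_cst _ t))); rewrite subr0.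
have cginv x : ccont (fun t => (gam t - omx x)^-1).
  by apply: cderive_ccont => t; eexists; exact: is_cderiveV (gn x t) (dgt x t).
have key : Cintegral I (g pi) = Cintegral I (g 0).
  apply: (@Cintegral_family_cst g dg H (r * r / m ^+ 2)).
  - move=> x t; have h := is_cderiveB (is_cderive_cst (gam t) x) (domx x).
    apply: (is_cderive_eq (is_cderiveZ (dgam t) (is_cderiveV (gn x t) h))).
    by rewrite /dg sub0r opprK !mulrA.
  - by move=> x; apply: ccontM; [exact: dgam_ccont|exact: cginv].
  - move=> x t; rewrite /dg cmodM [cmod (dgam t * _)]cmodM cmod_dgam cmodM cmodR.
    rewrite cmodV expr2 cmodM -mulrA.
    rewrite mulrA; apply: ler_pM; rewrite ?invr_ge0 ?mulr_ge0 ?cmod_ge0 ?(ltW r0) //.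
      rewrite ler_wpM2l ?(ltW r0) //; apply: le_trans (ltW omc).
      by rewrite ler_piMl ?cmod_ge0 // dbump_le.
    rewrite lef_pV2 ?posrE ?exprn_gt0 // ?mulr_gt0 ?cmod_gt0 //.
    by rewrite expr2 ler_pM ?(ltW m0).
  - move=> x; apply: ccontM; first by apply: ccontM; [exact: dgam_ccont|exact: ccont_cst].
    under eq_fun do rewrite expr2 invfM.
    by apply: ccontM.
  - move=> x t; apply: (is_cderive_eq (is_cderiveZ _ (is_cderiveV (gn x t) (dgt x t)))).
    by rewrite /dg; field.
  - by move=> x; rewrite /H gam_per.
have -> : (fun t => dgam t / (gam t - om)) = g pi.
  by apply/funext => t; rewrite /g /omx bumppi mul1r (addrC c) subrK.
rewrite key.
have -> : g 0 = fun=> 'i%C * 1.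
  apply/funext => t; rewrite /g /omx bump0 mul0r addr0 /gam addrC addKr /dgam mulr1.
  by rewrite -(mulrA 'i%C r%:C) mulfK // -cmod_gt0 cmodM cmod_expi cmodR mulr1 normr_gt0 gt_eqF.
rewrite CintegralZ; last exact: ccont_cst.
by rewrite Cintegral1 mulrC.
Qed.

Hypothesis sub_slit : [set z | cmod (z - c) <= r] `<=` (@slit_plane R).

(** The dilations z = om + b (gam - om) contract the circle to om inside the disc.
    The derivative in b of chi(z) / (gam - om) * gam' is chi'(z) gam', which is
    the derivative in t of chi(z) / b; at b = 0 only chi(om) times the winding
    number remains. *)
Lemma cauchy_chi :
  Cintegral I (fun t => @chi R (gam t) / (gam t - om) * dgam t) = chi om * ((2 * pi)%:C * 'i%C).
Proof.
pose z x t := om + (bump x)%:C * (gam t - om).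
have zc x t : cmod (z x t - c) <= r.
  have -> : z x t - c = (1 - bump x)%:C * (om - c) + (bump x)%:C * (gam t - c).
    by rewrite /z rmorphB rmorph1; ring.
  have /andP[b0 b1] := bump_01 x.
  apply: le_trans (cmodD _ _) _; rewrite !cmodM !cmodR cmod_gam !ger0_norm ?subr_ge0 //.
  have := ler_wpM2l (_ : 0 <= 1 - bump x) (ltW omc); rewrite subr_ge0 => /(_ b1); lra.
have zs x t : slit_plane (z x t) := sub_slit (zc x t).
have c_r : r < cmod c.
  rewrite ltNge; apply/negP => h.
  have : slit_plane (0 : C) by apply: sub_slit => /=; rewrite sub0r cmodN.
  by apply => /=.
pose m := cmod c - r; have m0 : 0 < m by rewrite subr_gt0.
have zm x t : m <= cmod (z x t).
  have := cmod_subr_le c (c - z x t); rewrite subKr cmodB; have := zc x t; rewrite /m; lra.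
have zM x t : cmod (z x t) <= cmod c + r.
  have := cmodD (z x t - c) c; have := zc x t; rewrite subrK; lra.
pose B := (1 + Num.sqrt (1 + 4 * (cmod c + r))) / (2 * m).
have dB x t : cmod (dchi (z x t)) <= B.
  apply: le_trans (dchi_bound (zs x t)) _; apply: ler_pM.
  - by rewrite addr_ge0 ?sqrtr_ge0.
  - by rewrite invr_ge0 mulr_ge0 ?cmod_ge0.
  - by rewrite lerD2l ler_wsqrtr // lerD2l ler_wpM2l.
  - by rewrite lef_pV2 ?posrE ?mulr_gt0 // ?(lt_le_trans m0) // ler_wpM2l.
have dzt x t : is_cderive (z x) t ((bump x)%:C * dgam t).
  have h := is_cderiveB (gam_cderive t) (is_cderive_cst om t).
  apply: (is_cderive_eq (is_cderiveD (is_cderive_cst om t) (is_cderiveZ (bump x)%:C h))).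
  by rewrite subr0 add0r.
have dzx x t : is_cderive (z^~ t) x ((sin x / 2)%:C * (gam t - om)).
  have h := is_cderiveM (is_cderive_real (bump_derive x)) (is_cderive_cst (gam t - om) x).
  apply: (is_cderive_eq (is_cderiveD (is_cderive_cst om x) h)).
  by rewrite mulr0 addr0 add0r.
have dgt t : is_cderive (fun t => gam t - om) t (dgam t).
  by apply: (is_cderive_eq (is_cderiveB (gam_cderive t) (is_cderive_cst _ t))); rewrite subr0.
have cginv : ccont (fun t => (gam t - om)^-1).
  by apply: cderive_ccont => t; eexists; exact: is_cderiveV (gam_neq t) (dgt t).
have cchi x : ccont (fun t => @chi R (z x t)).
  by apply: cderive_ccont => t; eexists; exact: (chi_cdiff (zs x t) (erefl _) (dzt x t)).
pose g x t := (gam t - om)^-1 * dgam t * @chi R (z x t).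
pose dg x t := (sin x / 2)%:C * dchi (z x t) * dgam t.
(* Where the bump vanishes so does its derivative, and the quotient is then 0, as
   required. *)
pose H x t := ((sin x / 2)%:C / (bump x)%:C) * @chi R (z x t).
have key : Cintegral I (g pi) = Cintegral I (g 0).
  apply: (@Cintegral_family_cst g dg H (1 * B * r)).
  - move=> x t; have h := chi_cdiff (zs x t) (f := z^~ t) (erefl _) (dzx x t).
    apply: (is_cderive_eq (is_cderiveZ ((gam t - om)^-1 * dgam t) h)).
    by rewrite /dg; field; exact: gam_neq.
  - by move=> x; apply: ccontM => //; apply: ccontM => //; exact: dgam_ccont.
  - move=> x t; rewrite /dg cmodM cmod_dgam cmodM cmodR ler_wpM2r ?(ltW r0) //.
    by apply: ler_pM; rewrite ?cmod_ge0 ?dbump_le.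
  - move=> x; apply: ccontM; last exact: dgam_ccont.
    apply: ccontM; first exact: ccont_cst.
    by apply: cderive_ccont => t; exact: dchi_derivable (dzt x t) (zs x t).
  - move=> x t; have h := chi_cdiff (zs x t) (erefl (z x t)) (dzt x t).
    apply: (is_cderive_eq (is_cderiveZ _ h)); rewrite /dg.
    have [b0|b0] := eqVneq (bump x) 0.
      by rewrite (bump_eq0 b0) mul0r rmorph0 !mul0r.
    have b1 : (bump x)%:C != 0 by rewrite (inj_eq (@complexI R) _ 0).
    by field.
  - by move=> x; rewrite /H /z gam_per.
have -> : (fun t => chi (gam t) / (gam t - om) * dgam t) = g pi.
  apply/funext => t; rewrite /g /z bumppi mul1r (addrC om) subrK; ring.
rewrite key.
have -> : g 0 = fun t => chi om * (dgam t / (gam t - om)).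
  by apply/funext => t; rewrite /g /z bump0 mul0r addr0; ring.
have h : ccont (fun t => dgam t / (gam t - om)) by apply: ccontM cginv; exact: dgam_ccont.
by rewrite (CintegralZ (chi om) h); congr (_ * _); exact: winding.
Qed.

Lemma kernel_ccont : ccont (fun t => @chi R (gam t) / (gam t - om) * dgam t).
Proof.
apply: ccontM; last exact: dgam_ccont.
apply: ccontM; apply: cderive_ccont => t; eexists.
  apply: (chi_cdiff _ (erefl _) (gam_cderive t)).
  by apply: sub_slit; rewrite /= cmod_gam.
apply: is_cderiveV (gam_neq t) _.
exact: is_cderiveB (gam_cderive t) (is_cderive_cst om t).
Qed.

End Circle.

End CauchyFormula.

(** * The function chi of a diagonalisable matrix *)

Section ChiMatrix.
Context {R : realType} {n : nat}.
Local Notation C := R[i].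
Local Open Scope complex_scope.

(** The resolvent acts on the eigenvalues, which reduces the matrix integral to
    Cauchy's formula at each of them. *)
Lemma resolvent_diag (Q : 'M[C]_n) (d : 'I_n -> C) z : Q \in unitmx ->
  (forall i, z != d i) ->
  invmx (z%:M - Q *m diag_mx (\row_i d i) *m invmx Q) =
  Q *m diag_mx (\row_i (z - d i)^-1) *m invmx Q.
Proof.
move=> Qu zd; apply: invmx_right.
have -> : z%:M - Q *m diag_mx (\row_i d i) *m invmx Q =
    Q *m diag_mx (\row_i (z - d i)) *m invmx Q.
  have -> : diag_mx (\row_i (z - d i)) = z%:M - diag_mx (\row_i d i).
    by apply/matrixP => i j; rewrite !mxE mulrnBl.
  by rewrite mulmxBr mulmxBl mul_mx_scalar -scalemxAl mulmxV // scalemx1.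
rewrite !mulmxA mulmxKV // -(mulmxA Q) mulmx_diag.
rewrite (_ : diag_mx _ = 1%:M) ?mulmx1 ?mulmxV //.
apply/matrixP => i j; rewrite !mxE mulfV //.
by rewrite subr_eq0.
Qed.

Variables (Q : 'M[R]_n) (d : 'I_n -> R).
Hypotheses (Qu : Q \in unitmx) (d0 : forall i, 0 < d i).
Let M := Q *m diag_mx (\row_i d i) *m invmx Q.

Let Qcu : complexmx Q \in unitmx.
Proof. by rewrite (map_unitmx (real_complex R)). Qed.

Lemma complexmx_diag (e : 'I_n -> R) :
  complexmx (Q *m diag_mx (\row_i e i) *m invmx Q) =
  complexmx Q *m diag_mx (\row_i (e i)%:C) *m invmx (complexmx Q).
Proof.
rewrite /complexmx !(map_mxM (real_complex R)) (map_invmx (real_complex R)).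
congr (_ *m _ *m _); rewrite (map_diag_mx (real_complex R)); congr diag_mx.
by apply/rowP => i; rewrite !mxE.
Qed.

Lemma eigenvalue_diag l : eigenvalue (complexmx M) l <-> exists i, l = (d i)%:C.
Proof.
rewrite complexmx_diag; split.
  move=> /eigenvalueP[v vl v0].
  pose u := v *m complexmx Q.
  have u0 : u != 0.
    by apply/eqP => h; case/eqP: v0; rewrite -[v](mulmxK Qcu) -/u h mul0mx.
  have ul : u *m diag_mx (\row_i (d i)%:C) = l *: u.
    have := congr1 (mulmx^~ (complexmx Q)) vl.
    by rewrite /u !mulmxA mulmxKV // scalemxAl.
  clearbody u; have [j uj] : exists j, u 0 j != 0.
    apply/existsP; move: u0; apply: contraNT; rewrite negb_exists => /forallP h.
    by apply/eqP/rowP => j; rewrite [RHS]mxE; apply/eqP; have := h j; rewrite negbK.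
  exists j; have := congr1 (fun w : 'rV_n => w 0 j) ul.
  by rewrite mul_mx_diag !mxE mulrC => /(mulIf uj).
move=> [i ->]; apply/eigenvalueP; exists (row i (invmx (complexmx Q))).
  rewrite rowE -!mulmxA (mulmxA (invmx _)) mulVmx // mul1mx mulmxA.
  have -> : delta_mx 0 i *m diag_mx (\row_i (d i)%:C) = (d i)%:C *: delta_mx 0 i :> 'rV_n.
    by rewrite -rowE row_diag_mx mxE.
  by rewrite scalemxAl.
apply/eqP => h.
have : row i (1%:M : 'M[C]_n) = 0.
  by rewrite -(mulVmx Qcu) row_mul h mul0mx.
by move/rowP/(_ i)/eqP; rewrite !mxE eqxx oner_eq0.
Qed.

Lemma cauchy_mx_chi c r : 0 < r ->
  [set z | cmod (z - c) <= r] `<=` (@slit_plane R) ->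
  (forall i, cmod ((d i)%:C - c) < r) ->
  cauchy_mx (@chi R) (complexmx M) c r =
  complexmx (Q *m diag_mx (\row_i chiR (d i)) *m invmx Q).
Proof.
move=> r0 sub dc; rewrite !complexmx_diag; apply/matrixP => j k; rewrite mxE.
pose gam t : C := c + r%:C * expi t.
pose co l := complexmx Q j l * invmx (complexmx Q) l k.
pose ker l t := @chi R (gam t) / (gam t - (d l)%:C) * ('i%C * r%:C * expi t).
have -> : (fun t => let z := c + r%:C * expi t in
     chi z * invmx (z%:M - complexmx Q *m diag_mx (\row_i (d i)%:C) *m invmx (complexmx Q)) j k *
     ('i%C * r%:C * expi t)) = fun t => \sum_l co l * ker l t.
  apply/funext => t /=; rewrite resolvent_diag //; last first.
    by move=> i; rewrite -subr_eq0; exact: gam_neq.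
  rewrite mxE mulr_sumr mulr_suml; apply: eq_bigr => l _.
  rewrite /co /ker /gam; move: (invmx (complexmx Q)) (complexmx Q) => B A.
  by rewrite mul_mx_diag !mxE; ring.
have ck l : ccont (ker l) by exact: kernel_ccont.
rewrite Cintegral_sum; last by move=> l; apply: ccontM => //; exact: ccont_cst.
rewrite mxE mulr_sumr; apply: eq_bigr => l _.
rewrite CintegralZ // cauchy_chi // chi_real // /co.
move: (invmx (complexmx Q)) (complexmx Q) => B A; rewrite mul_mx_diag !mxE.
have p0 : (2 * pi)%:C * 'i%C != 0 :> C.
  by rewrite -cmod_gt0 cmodM cmod_i mulr1 cmodR normr_gt0 gt_eqF ?twopi_gt0.
by move: (_ * 'i%C) p0 => p p0; field.
Qed.

(** Some admissible circle exists, and by [cauchy_mx_chi] every admissible circle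
    gives the same matrix, so the chosen value is that one. *)
Theorem chi_mx_diag : chi_mx M = Q *m diag_mx (\row_i chiR (d i)) *m invmx Q.
Proof.
pose P := [set N | exists c r, [/\ 0 < r, [set z | cmod (z - c) <= r] `<=` (@slit_plane R),
   forall l, eigenvalue (complexmx M) l -> cmod (l - c) < r &
   N = cauchy_mx (@chi R) (complexmx M) c r]].
suff -> : chi_mx M =
    map_mx (@complex.Re R) (complexmx (Q *m diag_mx (\row_i chiR (d i)) *m invmx Q)).
  by apply/matrixP => i j; rewrite !mxE.
rewrite /chi_mx /holo_mx -/P; congr map_mx.
suff [N PN] : exists N, P N.
  have [c [r [r0 sub ev ->]]] : P (xget 0 P) by apply: xgetPex; exists N.
  apply: cauchy_mx_chi => // i; apply: ev; apply/eigenvalue_diag; by exists i.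
have [e e0 ed] := pos_family_lb d0.
(* As e <= d_i <= c - e, the circle of centre c and radius c - e/2 encloses every
   d_i and has e/2 as its leftmost point. *)
pose c : R := \sum_i d i + e.
have dc i : d i + e <= c.
  rewrite /c lerD2r (bigD1 i) //= lerDl; apply: sumr_ge0 => j _; exact: ltW.
have c0 : e <= c by rewrite lerDr; apply: sumr_ge0 => j _; exact: ltW.
eexists; exists c%:C, (c - e / 2); split; last by [].
- lra.
- move=> z /= zc [h1 h2].
  have := cmod_Re (z - c%:C); have -> : complex.Re (z - c%:C) = complex.Re z - c.
    by case: (z).
  rewrite ler_norml => /andP[h3 _]; lra.
- move=> l /eigenvalue_diag[i ->]; rewrite -rmorphB /= cmodR ltr_norml.
  have := dc i; have := ed i => h1 h2; apply/andP; split; lra.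
Qed.

End ChiMatrix.

(** * The matrix exponential *)

Section MatrixExponential.
Context {R : realType} {n : nat}.
Implicit Types A : 'M[R]_n.

Lemma cvg_mx_entries (u : nat -> 'M[R]_n) (L : 'M[R]_n) :
  (forall i j, u k i j @[k --> \oo] --> L i j) -> u @ \oo --> L.
Proof.
move=> uL; apply/cvgrPdist_le => e e0.
have := @mxcvg_near _ _ _ _ _ _ u L e e0 uL; move=> /(_ _)/=; apply: filterS => k h.
rewrite [leLHS]/Num.Def.normr /= mx_normrE; apply: bigmax_le; first exact: ltW.
by move=> [i j] _; rewrite !mxE /= distrC.
Qed.

(** The exponential is studied through its entries, which are scalar power
    series in t. *)
Definition expcoef A i j (k : nat) : R := (k`!%:R)^-1 * (A ^+ k) i j.

Lemma exprZmx (t : R) A k : (t *: A) ^+ k = t ^+ k *: A ^+ k.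
Proof.
elim: k => [|k IH]; first by rewrite !expr0 scale1r.
by rewrite !exprS IH -[LHS]/((t *: A) *m _) -scalemxAl -scalemxAr scalerA.
Qed.

Let N A : R := \sum_i \sum_j `|A i j|.

Let N0 A : 0 <= N A.
Proof. by apply: sumr_ge0 => i _; apply: sumr_ge0. Qed.

Lemma expr_entry_le A k i j : `|(A ^+ k) i j| <= N A ^+ k.
Proof.
elim: k i j => [|k IH] i j.
  by rewrite !expr0 mxE; case: (i == j); rewrite ?normr1 ?normr0.
rewrite exprS -[_ * _]/(A *m _) mxE exprS mulr_suml.
apply: le_trans (ler_norm_sum _ _ _) _; rewrite [leRHS](bigD1 i) //= mulr_suml.
rewrite -[leLHS]addr0; apply: lerD; last first.
  by apply: sumr_ge0 => l _; rewrite mulr_ge0 ?exprn_ge0 // sumr_ge0.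
by apply: ler_sum => l _; rewrite normrM ler_wpM2l.
Qed.

Lemma cvg_pseries_bound (c : nat -> R) (B M K : R) : 0 <= B -> 0 <= M ->
  (forall k, `|c k| <= B * (M ^+ k / k`!%:R)) -> cvgn (pseries c K).
Proof.
move=> B0 M0 cB; apply: normed_cvg.
apply: (@series_le_cvg _ _ (B *: exp_coeff (M * `|K|))).
- by move=> k /=.
- by move=> k; rewrite /= mulr_ge0 // exp_coeff_ge0 // mulr_ge0.
- move=> k /=; rewrite normrM normrX.
  apply: le_trans (ler_wpM2r _ (cB k)) _; first exact: exprn_ge0.
  rewrite -[leRHS]/(B * ((M * `|K|) ^+ k / k`!%:R)) exprMn le_eqVlt.
  by apply/orP; left; apply/eqP; ring.
- by apply: is_cvg_seriesZ; exact: is_cvg_series_exp_coeff.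
Qed.

Lemma expcoef_cvg A i j K : cvgn (pseries (expcoef A i j) K).
Proof.
apply: (@cvg_pseries_bound _ 1 (N A)) => // k.
rewrite mul1r normrM mulrC [X in _ * X]gtr0_norm ?invr_gt0 ?ltr0n ?fact_gt0 //.
by rewrite ler_wpM2r ?invr_ge0 // expr_entry_le.
Qed.

Lemma expmx_entry A t i j :
  expmx (t *: A) i j = limn (pseries (expcoef A i j) t).
Proof.
pose L := \matrix_(i, j) limn (pseries (expcoef A i j) t).
suff -> : expmx (t *: A) = L by rewrite mxE.
apply/cvg_lim; first exact: norm_hausdorff.
apply: cvg_mx_entries => k l; rewrite mxE.
rewrite (_ : (fun m => _) = pseries (expcoef A k l) t); first exact: expcoef_cvg.
apply/funext => m.
rewrite /pseries /series /= summxE; apply: eq_bigr => p _.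
by rewrite exprZmx !mxE /expcoef; ring.
Qed.

Lemma pseries_diffs_expcoefl A i j :
  pseries_diffs (expcoef A i j) = fun k => \sum_l A i l * expcoef A l j k.
Proof.
apply/funext => k; rewrite /pseries_diffs /expcoef exprS -[A * _]/(A *m _) mxE.
rewrite factS natrM invfM mulrA mulrA mulfV ?pnatr_eq0 // mul1r mulr_sumr.
by apply: eq_bigr => l _; ring.
Qed.

Lemma pseries_diffs_expcoefr A i j :
  pseries_diffs (expcoef A i j) = fun k => \sum_l A l j * expcoef A i l k.
Proof.
apply/funext => k; rewrite /pseries_diffs /expcoef exprSr -[_ * A]/(_ *m A) mxE.
rewrite factS natrM invfM mulrA mulrA mulfV ?pnatr_eq0 // mul1r mulr_sumr.
by apply: eq_bigr => l _; ring.
Qed.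

(** The differentiated series of an entry is a combination of the original series
    of entries, with coefficients from A: this yields at once its convergence
    and the equation (e^(tA))' = A e^(tA). *)
Lemma pseries_lincomb (c : 'I_n -> nat -> R) (a : 'I_n -> R) (K : R) :
  (forall l, cvgn (pseries (c l) K)) ->
  pseries (fun k => \sum_l a l * c l k) K @ \oo --> \sum_l a l * limn (pseries (c l) K).
Proof.
move=> cc.
have -> : pseries (fun k => \sum_l a l * c l k) K = fun k => \sum_l a l * pseries (c l) K k.
  apply/funext => k; rewrite /pseries /series /=.
  under [RHS]eq_bigr do rewrite mulr_sumr.
  rewrite exchange_big /=; apply: eq_bigr => m _.
  by rewrite mulr_suml; apply: eq_bigr => l _; rewrite mulrA.
by apply: cvg_bigsum => l _; apply: cvgM; [exact: cvg_cst|exact: cc].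
Qed.

Lemma expcoef_diffs_cvg A i j K : cvgn (pseries (pseries_diffs (expcoef A i j)) K).
Proof.
rewrite pseries_diffs_expcoefl; apply/cvg_ex; eexists.
by apply: pseries_lincomb => l; exact: expcoef_cvg.
Qed.

Lemma expcoef_diffs2_cvg A i j K :
  cvgn (pseries (pseries_diffs (pseries_diffs (expcoef A i j))) K).
Proof.
have -> : pseries_diffs (pseries_diffs (expcoef A i j)) =
    fun k => \sum_l A i l * pseries_diffs (expcoef A l j) k.
  rewrite pseries_diffs_expcoefl; apply/funext => k.
  by rewrite [LHS]/pseries_diffs mulr_sumr; apply: eq_bigr => l _; rewrite /pseries_diffs mulrCA.
apply/cvg_ex; eexists.
by apply: pseries_lincomb => l; exact: expcoef_diffs_cvg.
Qed.

Lemma expmx_entry_derive A (t : R) i j :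
  is_derive t 1 (fun s => expmx (s *: A) i j) (limn (pseries (pseries_diffs (expcoef A i j)) t)).
Proof.
have -> : (fun s => expmx (s *: A) i j) = fun s => limn (pseries (expcoef A i j) s).
  by apply/funext => s; exact: expmx_entry.
apply: (@pseries_snd_diffs _ _ (`|t| + 1)).
- exact: expcoef_cvg.
- exact: expcoef_diffs_cvg.
- exact: expcoef_diffs2_cvg.
- by rewrite [ltRHS]ger0_norm ?addr_ge0 // ltrDl.
Qed.

Lemma expmx_dermxl A (t : R) :
  is_dermx t (fun s => expmx (s *: A)) (A *m expmx (t *: A)).
Proof.
move=> i j; apply: (is_derive_eq (expmx_entry_derive A t i j)).
rewrite pseries_diffs_expcoefl mxE; apply/cvg_lim => //.
under eq_bigr do rewrite expmx_entry.
by apply: pseries_lincomb => l; exact: expcoef_cvg.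
Qed.

Lemma expmx_dermxr A (t : R) :
  is_dermx t (fun s => expmx (s *: A)) (expmx (t *: A) *m A).
Proof.
move=> i j; apply: (is_derive_eq (expmx_entry_derive A t i j)).
rewrite pseries_diffs_expcoefr mxE; apply/cvg_lim => //.
under eq_bigr do rewrite expmx_entry mulrC.
by apply: pseries_lincomb => l; exact: expcoef_cvg.
Qed.

Lemma expmx0 A : expmx (0 *: A) = 1%:M.
Proof.
apply/matrixP => i j; rewrite expmx_entry.
have -> : (1%:M : 'M[R]_n) i j = expcoef A i j 0.
  by rewrite /expcoef fact0 invr1 mul1r expr0.
apply/cvg_lim => //; rewrite -cvg_shiftS /=.
apply: (@cvg_trans _ (cst (expcoef A i j 0) @ \oo)); last exact: cvg_cst.
apply: near_eq_cvg; apply: nearW => k /=.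
rewrite /pseries /series /= big_nat_recl // expr0 mulr1 big1 ?addr0 // => l _.
by rewrite expr0n mulr0.
Qed.

Lemma expmx_tr A (t : R) : expmx (t *: A^T) = (expmx (t *: A))^T.
Proof.
apply/matrixP => i j; rewrite mxE !expmx_entry; congr (limn (pseries _ _)).
apply/funext => k; rewrite /expcoef; congr (_ * _).
have -> : A^T ^+ k = (A ^+ k)^T; last by rewrite mxE.
elim: k => [|k IH]; first by rewrite !expr0 trmx1.
by rewrite exprS exprSr IH -[A^T * _]/(A^T *m _) -trmx_mul.
Qed.

(** The product of e^(-sA) and e^(sA) has derivative 0. *)
Lemma expmxN A (t : R) : expmx (- t *: A) *m expmx (t *: A) = 1%:M.
Proof.
pose F s := expmx (- s *: A) *m expmx (s *: A).
have dN s : is_dermx s (fun s => expmx (- s *: A)) (- (expmx (- s *: A) *m A)).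
  move=> i j; rewrite mxE -mulN1r mulrC.
  apply: (@is_derive1_comp _ (fun s => expmx (s *: A) i j) (fun s => - s) s).
  exact: expmx_dermxr.
have dF s : is_dermx s F 0.
  have := is_dermxM (dN s) (expmx_dermxl A s).
  by rewrite mulNmx mulmxA addNr.
have -> : expmx (- t *: A) *m expmx (t *: A) = F 0.
  apply/matrixP => i j.
  apply: (@is_derive_0_is_cst _ (fun s => F s i j) t 0) => s.
  by have := dF s i j; rewrite mxE.
by rewrite /F oppr0 expmx0 mulmx1.
Qed.

Lemma expmx_unit A (t : R) : expmx (t *: A) \in unitmx.
Proof. by have [] := mulmx1_unit (expmxN A t). Qed.

End MatrixExponential.

(** * The Gramian *)

Section Gramian.
Context {R : realType} {n : nat}.
Variables A D : 'M[R]_n.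
Local Notation mu := (@lebesgue_measure R).

Let W (s : R) := expmx (s *: A) *m D *m expmx (s *: A^T).

Lemma flow_dermx (S : 'M[R]_n) (t : R) :
  is_dermx t (fun s => expmx (s *: A) *m S *m expmx (s *: A^T))
   (A *m (expmx (t *: A) *m S *m expmx (t *: A^T))
    + (expmx (t *: A) *m S *m expmx (t *: A^T)) *m A^T).
Proof.
have h := is_dermxM (is_dermxM (expmx_dermxl A t) (is_dermx_cst t S)) (expmx_dermxr A^T t).
by move: h; rewrite mulmx0 addr0 !mulmxA.
Qed.

Lemma Gam_integrand_continuous i j : continuous (fun s => W s i j).
Proof. by move=> t; exact: (is_dermx_cvg (flow_dermx D t)). Qed.

Lemma Gam_integrand_integrable (a b : R) i j : mu.-integrable `[a, b] (EFin \o (fun s => W s i j)).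
Proof. exact/continuous_integrable_itv/Gam_integrand_continuous. Qed.

Lemma Gam_dermx (t : R) : 0 < t ->
  is_dermx t (Gam A D) (expmx (t *: A) *m D *m expmx (t *: A^T)).
Proof.
move=> t0 i j.
have t1 : t < t + 1 by rewrite ltrDl.
have [d e] := continuous_FTC1_closed t1
  (Gam_integrand_integrable 0 (t + 1) i j) t0 (@Gam_integrand_continuous i j t).
apply: DeriveDef.
  by under eq_fun do rewrite mxE; exact: d.
by under eq_fun do rewrite mxE; rewrite -derive1E; exact: e.
Qed.

Hypothesis Dpos : posdefmx D.

Lemma Gam_integrand_posdef s : posdefmx (W s).
Proof. by rewrite /W expmx_tr; apply: posdef_congr => //; exact: expmx_unit. Qed.

(** By the mean value theorem: the quadratic form of the Gramian vanishes at time
    0 and its derivative is the quadratic form of the integrand, which is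
    positive. *)
Lemma Gam_posdef (t : R) : 0 < t -> posdefmx (Gam A D t).
Proof.
move=> t0; split.
  apply/matrixP => i j; rewrite !mxE; apply: eq_Rintegral => s _.
  by have [Ws _] := Gam_integrand_posdef s; rewrite -/(W s) -[in LHS]Ws mxE.
move=> v v0.
pose q (s : R) := (v^T *m Gam A D s *m v) 0 0.
have qE s : q s = \sum_j \sum_i v i 0 * Gam A D s i j * v j 0.
  rewrite /q mxE; apply: eq_bigr => j _; rewrite mxE mulr_suml.
  by apply: eq_bigr => i _; rewrite mxE.
have dq (s : R) : 0 < s -> is_derive s 1 q ((v^T *m W s *m v) 0 0).
  move=> s0.
  have h := is_dermxM (is_dermxM (is_dermx_cst s v^T) (Gam_dermx s0)) (is_dermx_cst s v).
  by move: h; rewrite mul0mx add0r mulmx0 addr0 => /(_ 0 0).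
have cq : {within `[0, t], continuous q}.
  have -> : q = fun s => \sum_j \sum_i v i 0 * Gam A D s i j * v j 0 by apply/funext.
  move=> x; apply: cvg_bigsum => j _; apply: cvg_bigsum => i _.
  apply: cvgM; last exact: cvg_cst.
  apply: cvgM; first exact: cvg_cst.
  have E : (fun s => Gam A D s i j) =
      fun s => parameterized_integral mu 0 s (fun s => W s i j).
    by apply/funext => s; rewrite mxE.
  suff : {within `[0, t], continuous (fun s => Gam A D s i j)} by apply.
  by rewrite E; exact: (parameterized_integral_continuous (ltW t0)
    (Gam_integrand_integrable 0 t i j)).
have [c cI] : exists2 c, c \in `]0, t[ & q t - q 0 = (v^T *m W c *m v) 0 0 * (t - 0).
  apply: (@MVT _ q (fun s => (v^T *m W s *m v) 0 0)) => // x.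
  by rewrite in_itv /= => /andP[x0 _]; exact: dq.
have -> : q 0 = 0.
  rewrite qE big1 // => j _; rewrite big1 // => i _.
  by rewrite mxE set_itv1 Rintegral_set1 mulr0 mul0r.
rewrite !subr0 -/(q t) => ->; rewrite mulr_gt0 //.
by have [_] := Gam_integrand_posdef c; apply.
Qed.

End Gramian.

(** * Sign and zeros of the cost *)

Section TraceChi.
Context {R : realType} {n : nat}.
Implicit Types (N K W P U V : 'M[R]_n).

(** U V is not symmetric, but is similar to symmetric matrices; the trace of chi
    can be computed on any of them. *)
Lemma tr_chi_mx_similar N K W P a :
  orthogonalmx P -> K = specmx P a -> (forall i, 0 < a i) ->
  N \in unitmx -> N *m W = K *m N -> \tr (chi_mx W) = \sum_i chiR (a i).
Proof.
move=> Po KE a0 Nu NW.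
pose Q := invmx N *m P^T.
have QI : Q *m (P *m N) = 1%:M.
  by rewrite /Q mulmxA -(mulmxA _ P^T) (orthogonalmx_tr Po) mulmx1 mulVmx.
have [Qu _] := mulmx1_unit QI.
have QV : invmx Q = P *m N by exact: invmx_right.
have WE : W = Q *m diag_mx (\row_i a i) *m invmx Q.
  by rewrite -[LHS](mulKmx Nu) NW KE QV /Q /specmx !mulmxA.
rewrite WE chi_mx_diag // mxtrace_mulC mulmxA mulVmx // mul1mx mxtrace_diag.
by apply: eq_bigr => i _; rewrite mxE.
Qed.

(** The substitution w = u^2 + u removes the root, as 1 + 4 w = (2 u + 1)^2. *)
Lemma chiR_at (u : R) : 0 < u -> chiR (u * u + u) = - (2 * u + 1) - ln (2 * u).
Proof.
move=> u0; rewrite /chiR.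
have -> : 1 + 4 * (u * u + u) = (2 * u + 1) ^+ 2 by ring.
by rewrite sqrtr_sqr ger0_norm ?addr_ge0 ?mulr_ge0 ?ltW // addrK.
Qed.

Lemma dchiR_at (u : R) : 0 < u -> dchiR (u * u + u) = - u^-1.
Proof.
move=> u0; rewrite /dchiR.
have -> : 1 + 4 * (u * u + u) = (2 * u + 1) ^+ 2 by ring.
rewrite sqrtr_sqr ger0_norm ?addr_ge0 ?mulr_ge0 ?ltW //.
have u1 : u + 1 != 0 by rewrite gt_eqF // addr_gt0.
field; rewrite gt_eqF //=; have -> : u * u + u = u * (u + 1) by ring.
by rewrite mulf_neq0 // gt_eqF.
Qed.

Lemma ln_det2 P u : orthogonalmx P -> (forall i, 0 < u i) ->
  ln (\det (2 *: specmx P u)) = \sum_i ln (2 * u i).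
Proof.
move=> Po u0; rewrite specmxZ det_specmx // ln_bigprod // => i.
by rewrite mulr_gt0.
Qed.

(** Klein's inequality for chi at U^2 + U and U^(1/2) V U^(1/2): the slope is
    - U^-1, and Tr (U^-1 U^(1/2) V U^(1/2)) = Tr V. *)
Lemma cost_ge0 U V : posdefmx U -> posdefmx V ->
  0 <= ln (\det (2 *: U)) + \tr (U + V + chi_mx (U *m V)).
Proof.
move=> pU pV; have [ps ss] := posdef_sqrtmx pU; set s := sqrtmx U in ps ss.
have su := posdef_unit ps; have [ssym _] := ps.
have pK : posdefmx (s *m V *m s) by rewrite -{2}ssym; exact: posdef_congr.
have [P1 [k [P1o KE k0]]] := posdef_spec pK.
have [P [u [Po UE u0]]] := posdef_spec pU.
have chiE : \tr (chi_mx (U *m V)) = \sum_i chiR (k i).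
  apply: (@tr_chi_mx_similar (invmx s) _ _ P1 k P1o KE k0); first by rewrite unitmx_inv.
  by rewrite -ss -!mulmxA mulKmx // mulmxV // mulmx1.
rewrite !raddfD /= chiE.
pose a i := u i * u i + u i.
have a0 i : 0 < a i by rewrite addr_gt0 ?mulr_gt0.
have := @klein_ineq _ _ chiR dchiR P P1 a k Po P1o (fun i j => chiR_tangent (a0 i) (k0 j)).
rewrite -KE mulmxBr raddfB /= specmxM // tr_specmx //.
have -> : specmx P (dchiR \o a) = - invmx U.
  rewrite UE invmx_specmx // -scaleN1r specmxZ; apply: eq_specmx => i /=.
  by rewrite dchiR_at // mulN1r.
have -> : \tr (- invmx U *m (s *m V *m s)) = - \tr V.
  rewrite mulNmx raddfN /= mulmxA mxtrace_mulC -ss !mulmxA.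
  have -> : s *m invmx (s *m s) *m s = 1%:M.
    have e : invmx (s *m s) = invmx s *m invmx s.
      by apply: invmx_right; rewrite mulmxA mulmxK // mulmxV.
    by rewrite e mulmxA mulmxV // mul1mx mulVmx.
  by rewrite mul1mx.
rewrite [in X in _ -> X]UE ln_det2 // tr_specmx //.
have -> : \sum_i (dchiR \o a) i * a i = - \sum_i (u i + 1).
  rewrite -sumrN; apply: eq_bigr => i _ /=; rewrite dchiR_at // /a.
  by field; rewrite gt_eqF.
have -> : \sum_i chiR (a i) = - \sum_i (u i + 1) - \sum_i u i - \sum_i ln (2 * u i).
  rewrite -!sumrN -!big_split /=; apply: eq_bigr => i _; rewrite chiR_at //; ring.
lra.
Qed.

(** Here U V = U^2 + U, the point of tangency in [cost_ge0]. *)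
Lemma cost_eq0 U : posdefmx U ->
  ln (\det (2 *: U)) + \tr (U + (U + 1%:M) + chi_mx (U *m (U + 1%:M))) = 0.
Proof.
move=> /posdef_spec[P [u [Po -> u0]]].
have U1 : specmx P u + 1%:M = specmx P (fun i => u i + 1) by rewrite -(specmx1 Po) specmxD.
have a0 i : 0 < u i * (u i + 1) by rewrite mulr_gt0 // addr_gt0.
rewrite U1 specmxM // ln_det2 // !raddfD /= !tr_specmx //.
rewrite (@tr_chi_mx_similar 1%:M _ _ P _ Po erefl a0) ?unitmx1 ?mul1mx ?mulmx1 //.
rewrite -!big_split /= big1 // => i _.
by rewrite mulrDr mulr1 chiR_at //; ring.
Qed.

End TraceChi.

(** * Gradients on symmetric matrices *)

Section Symgrad.
Context {R : realType} {n : nat}.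
Implicit Types (f g : 'M[R]_n -> R) (X Phi : 'M[R]_n).

Lemma symgradD f g X Phi Psi : is_symgrad f X Phi -> is_symgrad g X Psi ->
  is_symgrad (fun Y => f Y + g Y) X (Phi + Psi).
Proof.
move=> [Ps fP] [Qs gP]; split; first by rewrite raddfD /= Ps Qs.
move=> e e0; have e2 : 0 < e / 2 by rewrite divr_gt0.
have h1 := fP _ e2; have h2 := gP _ e2; near=> H => Hs.
have k1 : `|f (X + H) - f X - \tr (Phi *m H)| <= e / 2 * `|H| by move: (Hs); near: H.
have k2 : `|g (X + H) - g X - \tr (Psi *m H)| <= e / 2 * `|H| by move: (Hs); near: H.
rewrite mulmxDl.
rewrite (_ : f (X + H) + g (X + H) - _ - _ =
  (f (X + H) - f X - \tr (Phi *m H)) + (g (X + H) - g X - \tr (Psi *m H))); last first.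
  by rewrite raddfD /=; ring.
apply: le_trans (ler_normD _ _) _; lra.
Unshelve. all: by end_near. Qed.

Lemma symgradN f X Phi : is_symgrad f X Phi -> is_symgrad (fun Y => - f Y) X (- Phi).
Proof.
move=> [Ps fP]; split; first by rewrite raddfN /= Ps.
move=> e e0; apply: filterS (fP e e0) => H h Hs.
have := h Hs; rewrite mulNmx raddfN /=.
rewrite (_ : - f (X + H) - - f X - _ = - (f (X + H) - f X - \tr (Phi *m H))) ?normrN //.
by ring.
Qed.

Lemma symgrad_linear (C : 'M[R]_n) (c : R) X : C^T = C ->
  is_symgrad (fun Y => \tr (C *m Y) + c) X C.
Proof.
move=> Cs; split=> // e e0; near=> H => _.
rewrite mulmxDr raddfD /= (_ : _ - _ - _ = 0); last by ring.
by rewrite normr0 mulr_ge0 // ltW.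
Unshelve. all: by end_near. Qed.

(** Symmetric increments of X that are small enough keep it positive definite, so
    the gradient only depends on the values at positive definite matrices. *)
Lemma symgrad_eq f g X Phi : posdefmx X -> (forall Y, posdefmx Y -> f Y = g Y) ->
  is_symgrad g X Phi -> is_symgrad f X Phi.
Proof.
move=> pX fg [Ps gP]; split=> // e e0.
have [d d0 Xd] := posdef_open pX.
have H0 : mxcvg (nbhs (0 : 'M[R]_n)) id 0.
  by move=> i j; exact: (@coord_continuous _ n n i j 0).
have hd := @mxcvg_near _ _ _ (nbhs_filter _) _ _ _ _ _ d0 H0.
have h := gP e e0; near=> H => Hs.
rewrite !fg //; first by move: (Hs); near: H.
apply: Xd; first by rewrite raddfD /= Hs (proj1 pX).
move=> i j; rewrite mxE [X in `|X|]addrC addKr.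
have : forall i j, `|H i j - (0 : 'M[R]_n) i j| <= d by near: H.
by move=> /(_ i j); rewrite [X in _ - X]mxE subr0.
Unshelve. all: by end_near. Qed.

End Symgrad.

(** * The algebraic identity behind the Hamilton-Jacobi equation *)

Section HJAlgebra.
Context {R : realType} {n : nat}.
Implicit Types (M Gi W th X The Y J : 'M[R]_n).

(** In J - J M J the products with M^-1 collapse, and all that remains of them
    and of J is - Gi - Y. *)
Lemma sandwich_expand M Gi Y : M \in unitmx ->
  let J := invmx M + Gi + Y in
  J - J *m M *m J = - Gi - Gi *m M *m Gi - Gi *m M *m Y - Y *m M *m Gi - (Y + Y *m M *m Y).
Proof.
move=> Mu J; rewrite /J !mulmxDl !mulmxDr mulVmx // !mul1mx !(mulmxK Mu).
move: (Gi *m M *m Gi) (Gi *m M *m Y) (Y *m M *m Gi) (Y *m M *m Y) (invmx M) => a b c d e.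
by apply/matrixP => i j; rewrite !mxE; ring.
Qed.

(** The left-hand side is the derivative of the cost in time, where W and M' stand
    for the derivatives of G and M; the right-hand side is the Hamiltonian at
    J = E^-T Phi E^-1. The terms in M' match by cyclicity. In those with W, the
    hypothesis on X turns Y + Y M Y into Gi The Gi. *)
Lemma hj_algebra M M' Gi W th X :
  M \in unitmx ->
  let K := th *m Gi *m M *m (Gi *m th) in
  X + X *m K *m X = 1%:M ->
  let Y := Gi *m th *m X *m (th *m Gi) in
  let J := invmx M + Gi + Y in
  let Gi' := - (Gi *m W *m Gi) in
  \tr (invmx M *m M') + \tr (- Gi *m W) + \tr (Gi' *m (M + th *m th) + Gi *m M') +
  \tr (X *m (th *m Gi' *m M *m (Gi *m th) + th *m Gi *m M' *m (Gi *m th)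
             + th *m Gi *m M *m (Gi' *m th)))
  = \tr (M' *m J) + \tr (W *m J) - \tr (W *m J *m M *m J).
Proof.
move=> Mu K XK Y J Gi'.
have YE : Y + Y *m M *m Y = Gi *m (th *m th) *m Gi.
  have -> : Y + Y *m M *m Y = Gi *m th *m (X + X *m K *m X) *m (th *m Gi).
    by rewrite /Y /K mulmxDr mulmxDl !mulmxA.
  by rewrite XK mulmx1 !mulmxA.
have WJ : \tr (W *m J) - \tr (W *m J *m M *m J) = \tr (W *m (J - J *m M *m J)).
  by rewrite mulmxBr raddfB /= !mulmxA.
have cyc (A B : 'M[R]_n) : \tr (A *m W *m B) = \tr (W *m (B *m A)).
  by rewrite -mulmxA mxtrace_mulC -mulmxA.
have cyc' (A B : 'M[R]_n) : \tr (A *m M' *m B) = \tr (M' *m (B *m A)).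
  by rewrite -mulmxA mxtrace_mulC -mulmxA.
have t1 : \tr (Gi' *m (M + th *m th)) =
    - \tr (W *m (Gi *m M *m Gi)) - \tr (W *m (Gi *m (th *m th) *m Gi)).
  rewrite /Gi' mulNmx raddfN /= mulmxDr raddfD /= -!(mulmxA (Gi *m W)) !cyc opprD.
  by rewrite !mulmxA.
have t2 : \tr (X *m (th *m Gi' *m M *m (Gi *m th))) = - \tr (W *m (Gi *m M *m Y)).
  rewrite /Gi' mulmxN !mulNmx mulmxN raddfN /=; congr (- _).
  rewrite (_ : X *m _ = (X *m th *m Gi) *m W *m (Gi *m M *m Gi *m th)); last by rewrite !mulmxA.
  by rewrite cyc /Y !mulmxA.
have t3 : \tr (X *m (th *m Gi *m M' *m (Gi *m th))) = \tr (M' *m Y).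
  rewrite (_ : X *m _ = (X *m th *m Gi) *m M' *m (Gi *m th)); last by rewrite !mulmxA.
  by rewrite cyc' /Y !mulmxA.
have t4 : \tr (X *m (th *m Gi *m M *m (Gi' *m th))) = - \tr (W *m (Y *m M *m Gi)).
  rewrite /Gi' mulNmx !mulmxN raddfN /=; congr (- _).
  rewrite (_ : X *m _ = (X *m th *m Gi *m M *m Gi) *m W *m (Gi *m th)); last by rewrite !mulmxA.
  by rewrite cyc /Y !mulmxA.
have t5 : \tr (M' *m J) = \tr (invmx M *m M') + \tr (Gi *m M') + \tr (M' *m Y).
  rewrite /J !mulmxDr !raddfD /=; congr (_ + _ + _); exact: mxtrace_mulC.
have t6 : \tr (W *m (J - J *m M *m J)) = \tr (- Gi *m W) - \tr (W *m (Gi *m M *m Gi))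
    - \tr (W *m (Gi *m M *m Y)) - \tr (W *m (Y *m M *m Gi)) - \tr (W *m (Gi *m (th *m th) *m Gi)).
  rewrite (sandwich_expand _ _ Mu) YE !mulmxBr !raddfB /=; congr (_ - _ - _ - _ - _).
  exact: mxtrace_mulC.
rewrite -addrA -[RHS]addrA WJ t5 t6 [X in _ + _ + (X + _)]raddfD /= t1.
rewrite !(mulmxDr X) [X in _ + _ + (_ + X)]raddfD /= [X in _ + _ + (_ + (X + _))]raddfD /= t2 t3 t4.
ring.
Qed.

End HJAlgebra.

(** * The cost as a function of time and covariance *)

Section Assembly.
Context {R : realType} {n : nat}.
Variables A D : 'M[R]_n.
Hypothesis Dpos : posdefmx D.

Let E (t : R) := expmx (t *: A).
Let M t S := E t *m S *m expmx (t *: A^T).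
Let G t := Gam A D t.
Let Gi t := invmx (G t).

Lemma invsqrtmxP (X : 'M[R]_n) : posdefmx X ->
  let h := invsqrtmx X in [/\ posdefmx h, h *m h = invmx X & h *m X *m h = 1%:M].
Proof.
move=> pX h; have [ps ss] := posdef_sqrtmx pX; have su := posdef_unit ps.
split; first exact: posdef_inv.
  apply/esym/invmx_right; rewrite -{1}ss /h /invsqrtmx mulmxA mulmxK //.
  by rewrite mulmxV.
by rewrite -{1}ss /h /invsqrtmx mulmxA mulVmx // mul1mx mulmxV.
Qed.

Lemma transported_posdef t S : posdefmx S -> posdefmx (M t S).
Proof. by move=> pS; rewrite /M expmx_tr; apply: posdef_congr => //; exact: expmx_unit. Qed.

Lemma UT_sandwich t S : 0 < t -> let h := invsqrtmx (G t) in UT A D t S = h *m M t S *m h.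
Proof.
move=> t0 h; have [ph hh hGh] := invsqrtmxP (Gam_posdef A Dpos t0).
by rewrite /UT /Ct mulmxDr mulmxDl hGh addrK.
Qed.

Lemma UT_posdef t S : 0 < t -> posdefmx S -> posdefmx (UT A D t S).
Proof.
move=> t0 pS; rewrite UT_sandwich //; have [ph _ _] := invsqrtmxP (Gam_posdef A Dpos t0).
have [hs _] := ph; rewrite -{2}hs; apply: posdef_congr; first exact: posdef_unit.
exact: transported_posdef.
Qed.

Lemma VT_posdef t S : 0 < t -> posdefmx S -> posdefmx (VT A D t S).
Proof.
move=> t0 pS; have [ph _ _] := invsqrtmxP (Gam_posdef A Dpos t0).
have [hs _] := ph; rewrite /VT -{2}hs; apply: posdef_congr => //; exact: posdef_unit.
Qed.

Lemma ST_ge0 t S The : 0 < t -> posdefmx S -> posdefmx The -> 0 <= ST A D t S The.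
Proof. by move=> t0 pS pT; apply: cost_ge0; [exact: UT_posdef|exact: VT_posdef]. Qed.

Lemma ST_Ct t S : 0 < t -> posdefmx S -> ST A D t S (Ct A D t S) = 0.
Proof.
move=> t0 pS; rewrite /ST.
have -> : VT A D t (Ct A D t S) = UT A D t S + 1%:M by rewrite /UT subrK.
exact/cost_eq0/UT_posdef.
Qed.

Variable The : 'M[R]_n.
Hypothesis Tpos : posdefmx The.
Let th := sqrtmx The.

(** U V is similar to the symmetric matrix in the last term through
    The^(1/2) h, h being the inverse root of the Gramian; the other terms only
    need h h = G^-1. *)
Lemma ST_transported t S : 0 < t -> posdefmx S ->
  ST A D t S The = ln (2 ^+ n) - \tr (mxfun (fun x => - ln x) (M t S))
    + \tr (mxfun (fun x => - ln x) (G t)) + \tr (Gi t *m (M t S + The))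
    + \tr (mxfun (@chiR R) (th *m Gi t *m M t S *m (Gi t *m th))).
Proof.
move=> t0 pS; have pG := Gam_posdef A Dpos t0; have pM := transported_posdef t pS.
have [ph hh hGh] := invsqrtmxP pG; rewrite -/(Gi t) -/(G t) in ph hh hGh.
have [pth tt] := posdef_sqrtmx Tpos; rewrite -/th in pth tt.
have [ts _] := pth; have [Gis _] := posdef_inv pG; rewrite -/(G t) -/(Gi t) in Gis.
have pK : posdefmx (th *m Gi t *m M t S *m (Gi t *m th)).
  have -> : Gi t *m th = (th *m Gi t)^T by rewrite trmx_mul ts Gis.
  apply: posdef_congr => //; rewrite unitmx_mul (posdef_unit pth).
  exact/posdef_unit/posdef_inv.
rewrite /ST UT_sandwich // -/(G t); set h := invsqrtmx (G t) in ph hh hGh *.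
rewrite !tr_mxfun_nln // !raddfD /=.
have -> : \tr (chi_mx (h *m M t S *m h *m VT A D t The)) =
    \tr (mxfun (@chiR R) (th *m Gi t *m M t S *m (Gi t *m th))).
  have [Ko KE K0] := eigdecP pK.
  rewrite (@tr_chi_mx_similar _ _ (th *m h) _ _ _ _ Ko KE K0); last 2 first.
  - by rewrite unitmx_mul !posdef_unit.
  - by rewrite /VT -/(G t) -/h -tt -hh !mulmxA.
  by rewrite /mxfun tr_specmx.
have -> : \tr (h *m M t S *m h) = \tr (Gi t *m M t S).
  by rewrite mxtrace_mulC mulmxA hh.
have -> : \tr (VT A D t The) = \tr (Gi t *m The).
  by rewrite /VT -/(G t) -/h mxtrace_mulC mulmxA hh.
have -> : ln (\det (2 *: (h *m M t S *m h))) = ln (2 ^+ n) + ln (\det (M t S)) - ln (\det (G t)).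
  have d : \det h * \det h * \det (G t) = 1.
    by rewrite -[RHS](@det1 R n) -hGh !det_mulmx; ring.
  have dG := posdef_det pG; rewrite -/(G t) in dG; have dM := posdef_det pM.
  rewrite detZ (det_mulmx (h *m M t S)) (det_mulmx h).
  have -> : \det h * \det (M t S) * \det h = \det (M t S) / \det (G t).
    have -> : \det (M t S) / \det (G t) =
        \det (M t S) * (\det h * \det h * \det (G t)) / \det (G t).
      by rewrite d mulr1.
    by field; rewrite gt_eqF.
  by rewrite lnM ?posrE ?exprn_gt0 ?divr_gt0 // ln_div ?posrE // addrA.
ring.
Qed.

Variables (T : R) (Sig : 'M[R]_n).
Hypotheses (T0 : 0 < T) (Spos : posdefmx Sig).

Let X := mxfun (@dchiR R) (th *m Gi T *m M T Sig *m (Gi T *m th)).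
Let Y := Gi T *m th *m X *m (th *m Gi T).
Let J := invmx (M T Sig) + Gi T + Y.
Let Phi := (E T)^T *m J *m E T.

Let pG := Gam_posdef A Dpos T0.
Let pM := transported_posdef T Spos.

Let ths : th^T = th. Proof. by have [[]] := posdef_sqrtmx Tpos. Qed.
Let thth : th *m th = The. Proof. by have [] := posdef_sqrtmx Tpos. Qed.
Let thu : th \in unitmx. Proof. by apply: posdef_unit; have [] := posdef_sqrtmx Tpos. Qed.
Let Gis : (Gi T)^T = Gi T. Proof. by have [] := posdef_inv pG. Qed.
Let Giu : Gi T \in unitmx. Proof. exact/posdef_unit/posdef_inv. Qed.
Let EtE t : expmx (t *: A^T) = (E t)^T. Proof. exact: expmx_tr. Qed.
Let thGiT : (th *m Gi T)^T = Gi T *m th. Proof. by rewrite trmx_mul ths Gis. Qed.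

(** The dependence on S is through the congruences by E and by
    The^(1/2) G^-1 E, to which [symgrad_tr_mxfun] applies, and through a linear
    term. *)
Lemma ST_symgrad : is_symgrad (fun S => ST A D T S The) Sig Phi.
Proof.
pose c := ln (2 ^+ n) + \tr (mxfun (fun x => - ln x) (G T)) + \tr (Gi T *m The).
pose f1 (S : 'M[R]_n) := - \tr (mxfun (fun x => - ln x) (E T *m S *m (E T)^T)).
pose f2 (S : 'M[R]_n) := \tr ((E T)^T *m Gi T *m E T *m S) + c.
pose f3 (S : 'M[R]_n) := \tr (mxfun (@chiR R) ((th *m Gi T *m E T) *m S *m (th *m Gi T *m E T)^T)).
apply: (@symgrad_eq _ _ _ (fun S => f1 S + f2 S + f3 S)) => //.
  move=> S pS; rewrite ST_transported // /f1 /f2 /f3 /c /M EtE.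
  have -> : \tr (Gi T *m (E T *m S *m (E T)^T + The)) =
      \tr ((E T)^T *m Gi T *m E T *m S) + \tr (Gi T *m The).
    rewrite mulmxDr raddfD /=; congr (_ + _).
    by rewrite mulmxA mxtrace_mulC !mulmxA.
  rewrite (trmx_mul (th *m Gi T)) thGiT !mulmxA; ring.
have g1 := symgradN (symgrad_tr_mxfun (@nln_tangent R) (@mxfun_oppV_cont R n)
  (expmx_unit A T) Spos).
have Cu : th *m Gi T *m E T \in unitmx.
  by rewrite !unitmx_mul thu Giu expmx_unit.
have g3 := symgrad_tr_mxfun (@chiR_tangent R) (@mxfun_dchiR_cont R n) Cu Spos.
have g2 : is_symgrad f2 Sig ((E T)^T *m Gi T *m E T).
  by apply: symgrad_linear; rewrite !trmx_mul trmxK Gis mulmxA.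
have := symgradD (symgradD g1 g2) g3.
suff -> : - ((E T)^T *m mxfun (fun x => - x^-1) (E T *m Sig *m (E T)^T) *m E T) +
    (E T)^T *m Gi T *m E T +
    (th *m Gi T *m E T)^T
      *m mxfun (@dchiR R) (th *m Gi T *m E T *m Sig *m (th *m Gi T *m E T)^T)
      *m (th *m Gi T *m E T) = Phi by [].
have ME : E T *m Sig *m (E T)^T = M T Sig by rewrite /M EtE.
rewrite ME mxfun_oppV // mulmxN mulNmx opprK.
have -> : th *m Gi T *m E T *m Sig *m (th *m Gi T *m E T)^T = th *m Gi T *m M T Sig *m (Gi T *m th).
  by rewrite (trmx_mul (th *m Gi T)) thGiT -ME !mulmxA.
by rewrite -/X (trmx_mul (th *m Gi T)) thGiT /Phi /J /Y !mulmxDr !mulmxDl !mulmxA.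
Qed.

Lemma expmx_comm t : E t *m A = A *m E t.
Proof.
apply/matrixP => i j.
by have [_ <-] := expmx_dermxr A t i j; have [_ <-] := expmx_dermxl A t i j.
Qed.

(** Since E commutes with A, conjugating by E turns the Lyapunov operator at Sig
    into the one at M and D into the derivative of the Gramian. *)
Lemma Fham_E : Fham A D Sig Phi =
  \tr ((A *m M T Sig + M T Sig *m A^T) *m J) + \tr (M T D *m J) - \tr (M T D *m J *m M T Sig *m J).
Proof.
have cE : A *m E T = E T *m A by rewrite expmx_comm.
have cEt : (E T)^T *m A^T = A^T *m (E T)^T by rewrite -!trmx_mul cE.
rewrite /Fham /Cgen mulmxBl (mulmxDl _ D) [LHS]raddfB /= [X in X - _ = _]raddfD /=.
congr (_ + _ - _).
- rewrite /Phi !mulmxA mxtrace_mulC !mulmxA; congr (\tr (_ *m J)).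
  rewrite mulmxDr mulmxDl /M EtE !mulmxA cE -!mulmxA cEt; congr (_ + _).
- by rewrite /Phi !mulmxA mxtrace_mulC !mulmxA /M EtE.
- by rewrite /Phi !mulmxA mxtrace_mulC !mulmxA /M EtE.
Qed.

Lemma ST_derive : is_derive T 1 (fun t => ST A D t Sig The) (Fham A D Sig Phi).
Proof.
have near0 : \forall t \near T, 0 < t by exact: lt_nbhsr.
pose f t := ln (2 ^+ n) - \tr (mxfun (fun x => - ln x) (M t Sig))
    + \tr (mxfun (fun x => - ln x) (G t)) + \tr (Gi t *m (M t Sig + The))
    + \tr (mxfun (@chiR R) (th *m Gi t *m M t Sig *m (Gi t *m th))).
apply: (@near_eq_is_derive _ _ _ f).
  by apply: filterS near0 => t t0; rewrite ST_transported.
have dM := flow_dermx A Sig T; rewrite -/(E T) -/(M T Sig) in dM.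
have dG := Gam_dermx A D T0.
have npG : \forall t \near T, posdefmx (G t).
  by apply: filterS near0 => t t0; exact: Gam_posdef.
have npM : \forall t \near T, posdefmx (M t Sig).
  by apply: filterS near0 => t t0; exact: transported_posdef.
have nuG : \forall t \near T, G t \in unitmx.
  by apply: filterS npG => t; exact: posdef_unit.
have dGi := is_dermx_inv nuG dG.
have dth := is_dermx_cst T th.
have dK := is_dermxM (is_dermxM (is_dermxM dth dGi) dM) (is_dermxM dGi dth).
have npK : \forall t \near T, posdefmx (th *m Gi t *m M t Sig *m (Gi t *m th)).
  near=> t.
  have pGt : posdefmx (Gi t) by apply: posdef_inv; near: t.
  have [Gts _] := pGt.
  have -> : Gi t *m th = (th *m Gi t)^T by rewrite trmx_mul ths Gts.
  apply: posdef_congr; last by near: t.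
  by rewrite unitmx_mul thu posdef_unit.
have d1 := is_derive_tr_mxfun (@nln_tangent R) (@mxfun_oppV_cont R n) npM dM.
have d2 := is_derive_tr_mxfun (@nln_tangent R) (@mxfun_oppV_cont R n) npG dG.
have d3 := is_derive_trmx (is_dermxM dGi (is_dermxD dM (is_dermx_cst T The))).
have d4 := is_derive_tr_mxfun (@chiR_tangent R) (@mxfun_dchiR_cont R n) npK dK.
have dc : is_derive T 1 (fun=> ln (2 ^+ n) : R) 0 by exact: is_derive_cst.
apply: (is_derive_eq (is_derive_add
  (is_derive_add (is_derive_add (is_derive_sub dc d1) d2) d3) d4)).
rewrite Fham_E mxfun_oppV // mxfun_oppV //.
rewrite !mul0mx !mulmx0 !add0r !addr0 mulNmx raddfN /= opprK.
have pK := nbhs_singleton npK.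
rewrite [in X in _ + \tr X = _](mulmxDl _ _ (invmx (G T) *m th)) -thth.
exact: (hj_algebra (A *m M T Sig + M T Sig *m A^T) (M T D) (posdef_unit pM)
  (mxfun_dchiR_riccati pK)).
Unshelve. all: by end_near. Qed.

End Assembly.

Theorem theorem4 (R : realType) (n m : nat) (A : 'M[R]_n) (B : 'M[R]_(n, m))
    (hA : hurwitz A) (hnm : (n <= m)%N) (hB : \rank B = n) :
  let D := B *m B^T in
  (forall (T : R) (Sig The : 'M[R]_n),
     0 < T -> posdefmx Sig -> posdefmx The ->
     0 <= ST A D T Sig The /\
     exists Phi : 'M[R]_n,
       is_symgrad (fun X => ST A D T X The) Sig Phi /\
       is_derive T 1 (fun t => ST A D t Sig The) (Fham A D Sig Phi)) /\
  (forall (T : R) (Sig : 'M[R]_n),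
     0 < T -> posdefmx Sig -> ST A D T Sig (Ct A D T Sig) = 0).
Proof.
move=> D; have Dpos : posdefmx D.
  split; first by rewrite /D trmx_mul trmxK.
  move=> v v0; have -> : v^T *m D *m v = (B^T *m v)^T *m (B^T *m v).
    by rewrite /D trmx_mul trmxK !mulmxA.
  apply: cV_sqnorm_gt0; apply: contraNneq v0 => h.
  have Bf : row_free B by rewrite /row_free hB.
  rewrite -[v]trmxK -(trmx0 _ 1 n); apply/eqP; congr trmx.
  by apply/eqP; rewrite -(mulmx_free_eq0 _ Bf) -[_ *m B]trmxK trmx_mul trmxK h trmx0.
split=> [T Sig The T0 pS pT|T Sig T0 pS]; last exact: ST_Ct.
split; first exact: ST_ge0.
eexists; split; first exact: ST_symgrad.
exact: ST_derive.
Qed.
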